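(* Consider the constrained convex problem $g^*:=\min_{x\in\Omega}g(x)$ with a solution $x^*$, let $\beta\in(0,0.15]$, and let $\{(x_{t_k},t_k)\}_{k\ge0}$ be a sequence generated by Phase II of the inexact path-following proximal-Newton algorithm described in the context. Then, after $\bar k\ge1$ iterations in Phase II, $$|g(x_{t_{\bar k}})-g(x^* )|\le\psi(\beta,\nu)\,t_{\bar k},$$ where $$\psi(\beta,\nu):=\nu+\sqrt\nu\,\frac{\beta}{1-0.4\sqrt\beta}+\frac{0.4\sqrt\beta}{(1-0.4\sqrt\beta)^2}\left(1.075\beta+0.4\sqrt\beta\right)+0.003\beta^2$$ is a constant. Consequently, the worst-case analytical complexity (number of iterations) of Phase II to achieve an $\varepsilon$-optimal solution, i.e. $|g(x_{t_{\bar k}})-g(x^* )|\le\varepsilon$, is $\mathcal{O}\left(\sqrt\nu\,\log\left(\frac{t_0\,\psi(\beta,\nu)}{\varepsilon}\right)\right)$.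
   Context: Self-concordance: a convex function $\varphi$ of one real variable is standard self-concordant if $|\varphi'''(\tau)|\le 2\varphi''(\tau)^{3/2}$ on its domain. A function $f:\mathrm{dom}(f)\subseteq\mathbb{R}^n\to\mathbb{R}$ is (standard) self-concordant if for all $x\in\mathrm{dom}(f)$ and $v\in\mathbb{R}^n$ the function $\tau\mapsto f(x+\tau v)$ is standard self-concordant on $\{\tau: x+\tau v\in\mathrm{dom}(f)\}$. As usual, $\mathrm{dom}(f)$ is open and convex, $f$ is convex and $C^3$ on it, and $f$ is closed (lower semicontinuous when extended by $+\infty$). It is a $\nu$-self-concordant barrier ($\nu>0$) for $\mathrm{Dom}(f):=\mathrm{cl}(\mathrm{dom}(f))$ if moreover $\sup_{u\in\mathbb{R}^n}\{2\nabla f(x)^Tu-\|u\|_x^2\}\le\nu$ for all $x\in\mathrm{dom}(f)$. Standing assumptions: $\Omega\subseteq\mathbb{R}^n$ is nonempty, closed and convex; $f$ is a $\nu$-self-concordant barrier with $\mathrm{Dom}(f)=\Omega$ and $\nabla^2f(x)\succ0$ on $\mathrm{dom}(f)$; $g:\mathbb{R}^n\to\mathbb{R}\cup\{+\infty\}$ is proper, lower semicontinuous and convex. Local norm: $\|u\|_x:=[u^T\nabla^2f(x)u]^{1/2}$. For $t>0$, $F(x;t):=f(x)+t^{-1}g(x)$ and $\mathrm{dom}(F):=\mathrm{dom}(f)\cap\mathrm{dom}(g)$. For each value of $t$ considered, $F(\cdot;t)$ is assumed to have a (necessarily unique) minimizer $x^*_t\in\mathrm{dom}(F)$. Proximal-Newton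 subproblem at $y\in\mathrm{dom}(F)$ with parameter $t$: minimize over $x\in\mathrm{dom}(F)$ the function $$\widehat F(x;t,y):=f(y)+\nabla f(y)^T(x-y)+\tfrac12(x-y)^T\nabla^2f(y)(x-y)+t^{-1}g(x).$$ It is assumed to have its (unique) exact solution $\bar x\in\mathrm{dom}(F)$. A point $x^+\in\mathrm{dom}(F)$ is a $\delta$-solution ($\delta\ge0$) if $\widehat F(x^+;t,y)-\widehat F(\bar x;t,y)\le\delta^2/2$. Phase II: start from $t_0>0$ and $x_{t_0}\in\mathrm{dom}(F)$ with $\|x_{t_0}-x^*_{t_0}\|_{x^*_{t_0}}\le\beta$ (produced by an initialization Phase I). For $k=0,1,\dots$, set $t_{k+1}:=(1-\sigma_\beta)t_k$, where $\sigma_\beta:=\frac{C(\beta)}{(1+C(\beta))\sqrt\nu}$ and $C(\beta):=\frac{\sqrt\beta-2.581\beta}{2.581+\sqrt\beta}$, and let $x_{t_{k+1}}$ be any $\delta_k$-solution of the subproblem at $x_{t_k}$ with parameter $t_{k+1}$, where $0\le\delta_k\le0.075\beta$. In the $\mathcal{O}$-statement $\beta$ is fixed, the implied constant depends only on $\beta$, and the regime is $\varepsilon$ small relative to $t_0\psi(\beta,\nu)$. *)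

(* Defs.v *)
From mathcomp Require Import all_boot all_order all_algebra.
From mathcomp Require Import all_classical all_reals all_analysis.

Set Implicit Arguments.
Unset Strict Implicit.
Unset Printing Implicit Defensive.

Import Order.TTheory GRing.Theory Num.Theory.
Import numFieldNormedType.Exports.

Local Open Scope classical_set_scope.
Local Open Scope ring_scope.

Section Calculus.
Context {R : realType} {n : nat}.
Local Notation V := 'cV[R]_n.
Implicit Types (D : set V) (f : V -> R) (x u v : V).

Definition dot u v : R := (u^T *m v) 0 0.

Definition grad f x : V := \col_i 'D_(delta_mx i 0) f x.

Definition hess f x : 'M[R]_n :=
  \matrix_(i, j) 'D_(delta_mx i 0) (fun y => 'D_(delta_mx j 0) f y) x.

Definition posdef (H : 'M[R]_n) : Prop := forall u, u != 0 -> 0 < dot u (H *m u).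

Definition local_norm f x u : R := Num.sqrt (dot u (hess f x *m u)).

(* [f] is C^k on the open set [D]; the derivative of [f], being a map into a
   finite-dimensional space, is C^k iff all its evaluations
   [y |-> 'D_v f y = 'd f y v] are. *)
Fixpoint Ck (k : nat) D f : Prop :=
  if k is k'.+1 then
    (forall x, D x -> differentiable f x) /\
    (forall v, Ck k' D (fun y => 'D_v f y))
  else forall x, D x -> {for x, continuous f}.

(* Functions with domain [D] are total Rocq functions whose values outside [D]
   are irrelevant; [extend D f] is the extension by +oo. *)
Definition extend D f : V -> \bar R := patch (fun=> +oo%E) D (EFin \o f).

End Calculus.

Definition std_self_concordant1 {R : realType} (I : set R) (phi : R -> R) : Prop :=
  convex_function (I : set R^o) (phi : R^o -> R^o) /\
  forall tau, I tau ->
    `|derive1n 3 phi tau| <= 2 * (derive1n 2 phi tau) `^ (3 / 2).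

Section Barrier.
Context {R : realType} {n : nat}.
Local Notation V := 'cV[R]_n.
Implicit Types (D Omega : set V) (f : V -> R).

Record self_concordant D f : Prop := SelfConcordant {
  sc_open : open D;
  sc_convex_dom : convex_set D;
  sc_convex : convex_function D (f : V -> R^o);
  sc_C3 : Ck 3 D f;
  sc_closed : lower_semicontinuous (extend D f);
  sc_line : forall x v : V, D x ->
    std_self_concordant1 [set tau : R | D (x + tau *: v)]
                         (fun tau : R => f (x + tau *: v)) }.

Record sc_barrier (nu : R) Omega D f : Prop := ScBarrier {
  scb_nu : 0 < nu;
  scb_sc : self_concordant D f;
  scb_Dom : closure D = Omega;
  scb_bound : forall x, D x ->
    (ereal_sup [set (2 * dot (grad f x) u - local_norm f x u ^+ 2)%:E | u in [set: V]]
       <= nu%:E)%E }.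

End Barrier.

Section ExtendedConvex.
Context {R : realType} {n : nat}.
Local Notation V := 'cV[R]_n.
Implicit Types (g : V -> \bar R).
Local Open Scope ereal_scope.

Definition edom g : set V := [set x | g x < +oo].

Definition eproper g : Prop := (forall x, -oo < g x) /\ (edom g !=set0).

(* Here 0 * +oo = 0, and no indeterminate sum arises as long as -oo is not a
   value of [g]. *)
Definition econvex g : Prop := forall (x y : V) (a : R), (0 <= a <= 1)%R ->
  g (a *: x + (1 - a) *: y)%R <= a%:E * g x + (1 - a)%:E * g y.

Definition is_argmin (A : set V) (h : V -> \bar R) (x : V) : Prop :=
  A x /\ forall y, A y -> h x <= h y.

End ExtendedConvex.

Section ProximalNewton.
Context {R : realType} {n : nat}.
Local Notation V := 'cV[R]_n.
Variables (D : set V) (f : V -> R) (g : V -> \bar R).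

Definition domF : set V := D `&` edom g.

Definition F (t : R) (x : V) : \bar R := ((f x)%:E + (t^-1)%:E * g x)%E.

Definition Fhat (t : R) (y x : V) : \bar R :=
  ((f y + dot (grad f y) (x - y)
    + 2^-1 * dot (x - y) (hess f y *m (x - y)))%:E + (t^-1)%:E * g x)%E.

Definition subproblem_solution (t : R) (y xbar : V) : Prop :=
  is_argmin domF (Fhat t y) xbar.

Definition delta_solution (t : R) (y xbar : V) (delta : R) (xp : V) : Prop :=
  domF xp /\ (Fhat t y xp - Fhat t y xbar <= (delta ^+ 2 / 2)%:E)%E.

End ProximalNewton.

Section Constants.
Context {R : realType}.
Implicit Types beta nu : R.

Definition Cbeta beta : R :=
  (Num.sqrt beta - 2581 / 1000 * beta) / (2581 / 1000 + Num.sqrt beta).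

Definition sigma beta nu : R := Cbeta beta / ((1 + Cbeta beta) * Num.sqrt nu).

Definition psi beta nu : R :=
  let r := 4 / 10 * Num.sqrt beta in
  nu + Num.sqrt nu * (beta / (1 - r))
  + r / (1 - r) ^+ 2 * (1075 / 1000 * beta + r)
  + 3 / 1000 * beta ^+ 2.

End Constants.

(* A run of Phase II: [xs k] is the minimizer of F(.; t_k) and [xbar k] the exact
   solution of the subproblem at iteration [k]. *)
Record phaseII {R : realType} {n : nat} (D : set 'cV[R]_n) (f : 'cV[R]_n -> R)
    (g : 'cV[R]_n -> \bar R) (nu beta : R)
    (t delta : nat -> R) (x xs xbar : nat -> 'cV[R]_n) : Prop := PhaseII {
  p2_t0 : 0 < t 0%N;
  p2_min : forall k, is_argmin (domF D g) (F f g (t k)) (xs k);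
  p2_x0 : domF D g (x 0%N);
  p2_init : local_norm f (xs 0%N) (x 0%N - xs 0%N) <= beta;
  p2_t : forall k, t k.+1 = (1 - sigma beta nu) * t k;
  p2_delta : forall k, 0 <= delta k <= 75 / 1000 * beta;
  p2_xbar : forall k, subproblem_solution D f g (t k.+1) (x k) (xbar k);
  p2_step : forall k,
    delta_solution D f g (t k.+1) (x k) (xbar k) (delta k) (x k.+1) }.

(* Main.v *)
Require Import Defs.
From mathcomp Require Import all_boot all_order all_algebra.
From mathcomp Require Import all_classical all_reals all_analysis.
From mathcomp Require Import ring lra.

Import Order.TTheory GRing.Theory Num.Theory.
Import numFieldNormedType.Exports.

Local Open Scope classical_set_scope.
Local Open Scope ring_scope.

(* Along a segment the local length of its direction has an inverse with slope at most
   1 in absolute value; by Banach's theorem on symmetric trilinear forms the Hessian of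
   a self-concordant function changes along the segment at a rate controlled by that
   length.  Hence at local distance r < 1 Hessians are comparable up to the factor
   (1 - r)^2, gradients are strongly monotone, and the first-order Taylor remainder of
   the gradient is at most r^2 / (1 - r).
   Feeding this into the optimality conditions shows, with dist measured at the new
   minimizer: consecutive minimizers are C(beta)-close, so an iterate beta-close to the
   old minimizer is sqrt(beta)/2.581-close to the new one, and an inexact Newton step
   makes it beta-close again.  The gap in g splits into g at the minimizer, at most
   nu t by the barrier inequality, and the difference between the iterate and the
   minimizer, read off the quadratic model.
   Nothing in the definition of a barrier says that sigma(beta) < 1; this needs nu >= 1.
   Dikin's ellipsoid turns the gradient bound with constant nu into the one with
   constant nu^2, so for nu < 1 iteration would force the gradient to vanish. *)

(** * Directional derivatives *)

Section Calculus.
Context {R : realType} {V : normedModType R}.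
Implicit Types (D : set V) (f : V -> R) (x u v w : V) (tau : R).

Lemma is_derive_line f x v tau : derivable f (x + tau *: v) v ->
  is_derive tau (1 : R) (fun s : R => f (x + s *: v)) ('D_v f (x + tau *: v)).
Proof.
have E : (fun h : R => h^-1 *: (((fun s : R => f (x + s *: v)) \o shift tau) (h *: 1) -
    f (x + tau *: v))) =
  (fun h : R => h^-1 *: ((f \o shift (x + tau *: v)) (h *: v) - f (x + tau *: v))).
  by apply/funext => h /=; rewrite [h *: 1]mulr1 scalerDl addrCA.
by move=> dfv; split; rewrite /derivable /derive E.
Qed.

Lemma derive_dirD f x u v : differentiable f x ->
  'D_(u + v) f x = 'D_u f x + 'D_v f x.
Proof. by move=> df; rewrite !deriveE// linearD. Qed.

Lemma derive_dirZ f x (k : R) u : differentiable f x ->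
  'D_(k *: u) f x = k * 'D_u f x.
Proof. by move=> df; rewrite !deriveE// linearZ. Qed.

Lemma derive_nondecreasing (phi dphi : R -> R) (a b : R) : a <= b ->
  (forall s, a <= s <= b -> is_derive s (1 : R) phi (dphi s)) ->
  (forall s, a <= s <= b -> 0 <= dphi s) -> phi a <= phi b.
Proof.
move=> ab dphiP dphi_ge0.
have [||c + E] := @MVT_segment R phi dphi a b ab.
- by move=> s; rewrite in_itv/= => /andP[? ?]; apply: dphiP; rewrite !ltW.
- apply: derivable_within_continuous => s; rewrite in_itv/= => sab.
  by have [] := dphiP _ sab.
rewrite in_itv/= => cab; rewrite -subr_ge0 E mulr_ge0 ?dphi_ge0// subr_ge0//.
Qed.

Lemma near_box {D} {x} u v : nbhs x D ->
  exists2 h : R, 0 < h & forall s t : R, 0 <= s <= h -> 0 <= t <= h ->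
    D (x + s *: u + t *: v).
Proof.
move=> /nbhs_ballP[e /= e0 xeD]; pose M := `|u| + `|v| + 1.
have M0 : 0 < M by rewrite ltr_wpDl// addr_ge0.
exists (e / M / 2); first by rewrite !divr_gt0.
move=> s t /andP[s0 sh] /andP[t0 th]; apply: xeD.
rewrite -ball_normE /ball_/= -addrA opprD addNKr normrN.
rewrite (le_lt_trans (ler_normD _ _))// !normrZ !ger0_norm//.
have h0 : 0 < e / M / 2 by rewrite !divr_gt0.
apply: (@le_lt_trans _ _ (e / M / 2 * M)); last first.
  by rewrite mulrAC divfK ?gt_eqF// ltr_pdivrMr// ltr_pMr// ltr1n.
rewrite /M !mulrDr mulr1 -[leLHS]addr0 lerD ?(ltW h0)//.
by rewrite lerD// ler_wpM2r.
Qed.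

(** Mean value theorem twice: first for [s |-> f (x + h *: v + s *: u) - f (x + s *: u)], then for
    the [u]-derivative of [f] in direction [v]. *)
Lemma second_difference D f x u v (h : R) : 0 < h ->
  (forall s t : R, 0 <= s <= h -> 0 <= t <= h -> D (x + s *: u + t *: v)) ->
  (forall y, D y -> derivable f y u) ->
  (forall y, D y -> derivable ('D_u f) y v) ->
  exists s t : R, [/\ 0 <= s <= h, 0 <= t <= h &
    f (x + h *: u + h *: v) - f (x + h *: u) - (f (x + h *: v) - f x) =
    'D_v ('D_u f) (x + s *: u + t *: v) * (h * h)].
Proof.
move=> h0 box df d2f.
have hh : 0 <= h <= h by rewrite (ltW h0) lexx.
have zh : 0 <= (0 : R) <= h by rewrite (ltW h0) lexx.
pose phi (s : R) := f (x + h *: v + s *: u) - f (x + s *: u).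
pose dphi (s : R) := 'D_u f (x + h *: v + s *: u) - 'D_u f (x + s *: u).
have phiP s : 0 <= s <= h -> is_derive s (1 : R) phi (dphi s).
  move=> sh; apply: is_deriveB; apply: is_derive_line; apply: df.
    by rewrite addrAC; exact: box.
  by rewrite -[_ + _]addr0 -(scale0r v); exact: box.
have [||s] := @MVT_segment R phi dphi 0 h (ltW h0).
- by move=> s; rewrite in_itv/= => /andP[? ?]; apply: phiP; rewrite !ltW.
- apply: derivable_within_continuous => s; rewrite in_itv/= => sh.
  by have [] := phiP _ sh.
rewrite in_itv/= subr0 => sh E1.
pose psi (t : R) := 'D_u f (x + s *: u + t *: v).
pose dpsi (t : R) := 'D_v ('D_u f) (x + s *: u + t *: v).
have psiP t : 0 <= t <= h -> is_derive t (1 : R) psi (dpsi t).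
  by move=> th; apply: (@is_derive_line ('D_u f)); apply: d2f; exact: box.
have [||t] := @MVT_segment R psi dpsi 0 h (ltW h0).
- by move=> t; rewrite in_itv/= => /andP[? ?]; apply: psiP; rewrite !ltW.
- apply: derivable_within_continuous => t; rewrite in_itv/= => th.
  by have [] := psiP _ th.
rewrite in_itv/= subr0 => th E2.
exists s, t; split => //.
move: E1; rewrite /phi /dphi !scale0r !addr0 (addrAC x (h *: v)) => ->.
move: E2; rewrite /psi /dpsi !scale0r !addr0 (addrAC x (h *: v)) => ->.
by rewrite mulrA.
Qed.

(** Schwarz's theorem: the second difference over a small parallelogram is symmetric in [u] and [v],
    and equals [h * h] times either mixed derivative at some point of it. Continuity at [x] then
    puts both derivatives at [x] within e / 2 of a common value. *)
Lemma derive_sym D f x u v : open D -> D x ->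
  (forall y, D y -> differentiable f y) ->
  (forall w y, D y -> differentiable ('D_w f) y) ->
  (forall w w', {for x, continuous ('D_w ('D_w' f))}) ->
  'D_u ('D_v f) x = 'D_v ('D_u f) x.
Proof.
move=> oD Dx df d2f cf; apply/eqP; rewrite -subr_eq0 -normr_le0.
apply/ler_addgt0Pl => /= e e0; rewrite addr0.
have e20 : 0 < e / 2 by rewrite divr_gt0.
have /cvgrPdist_le/(_ _ e20) Nuv := cf u v.
have /cvgrPdist_le/(_ _ e20) Nvu := cf v u.
have ND : nbhs x D by exact: open_nbhs_nbhs.
have [h h0 box] := near_box u v (filterI ND (filterI Nuv Nvu)).
have boxD s t (sh : 0 <= s <= h) (th : 0 <= t <= h) : D (x + s *: u + t *: v).
  by have [] := box s t sh th.
have boxD' s t (sh : 0 <= s <= h) (th : 0 <= t <= h) : D (x + s *: v + t *: u).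
  by rewrite addrAC; exact: boxD.
have [s [t [sh th E1]]] := @second_difference D f x u v h h0 boxD
  (fun y Dy => diff_derivable (df y Dy)) (fun y Dy => diff_derivable (d2f u y Dy)).
have [t' [s' [th' sh' E2]]] := @second_difference D f x v u h h0 boxD'
  (fun y Dy => diff_derivable (df y Dy)) (fun y Dy => diff_derivable (d2f v y Dy)).
have hh0 : h * h != 0 by rewrite mulf_neq0 ?gt_eqF.
have E0 : f (x + h *: v + h *: u) - f (x + h *: v) - (f (x + h *: u) - f x) =
    f (x + h *: u + h *: v) - f (x + h *: u) - (f (x + h *: v) - f x).
  have swap (a b c d : R) : a - b - (c - d) = a - c - (b - d) by ring.
  by rewrite (addrAC x (h *: v)) swap.
have E : 'D_v ('D_u f) (x + s *: u + t *: v) = 'D_u ('D_v f) (x + s' *: u + t' *: v).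
  move: E1; rewrite -E0 E2 => /(mulIf hh0) <-.
  by rewrite addrAC.
have [_ [_ B1]] := box _ _ sh th; have [_ [B2 _]] := box _ _ sh' th'.
pose y1 := 'D_u ('D_v f) x; pose y2 := 'D_v ('D_u f) x.
pose z := 'D_u ('D_v f) (x + s' *: u + t' *: v).
have {}B1 : `|y2 - z| <= e / 2 by rewrite /z -E; exact: B1.
have {}B2 : `|y1 - z| <= e / 2 by exact: B2.
rewrite -/y1 -/y2; move: y1 y2 z B1 B2 => y1 y2 z B1 B2.
rewrite (splitr e); apply: le_trans (ler_distD z y1 y2) _.
by rewrite (distrC z); exact: lerD.
Qed.

End Calculus.

(** * Trilinear forms on a Euclidean space *)

(* Equality case of Bernstein-Szego for cubic forms: if (c, s) has argument 3b, the
   directions at angles b + k pi / 3, k = 0, 1, 2, give a quadrature formula for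
   c a3 + s a2 whose weights (3 p_k^2 - q_k^2)^2 / 9 sum up to 1. *)
Lemma cubic_form_polar {R : realType} (a3 a2 a1 a0 M c s : R) :
  (forall p q : R, p ^+ 2 + q ^+ 2 = 1 ->
    `|p ^+ 3 * a3 + 3 * (p ^+ 2 * q * a2) + 3 * (p * q ^+ 2 * a1) + q ^+ 3 * a0| <= M) ->
  0 <= s -> c ^+ 2 + s ^+ 2 = 1 -> `|c * a3 + s * a2| <= M.
Proof.
move=> boundM s0 cs1.
have c11 : -1 <= c <= 1 by apply/andP; split; nra.
pose b := acos c / 3.
have bE : acos c = b + b + b by rewrite /b; field.
(* The sign of [s] matters here: [acos] takes values in [0, pi], where the sine is nonnegative. *)
have sE : s = sin (acos c).
  by rewrite sin_acos// -[LHS]ger0_norm// -sqrtr_sqr; congr Num.sqrt; lra.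
have cE : c = cos (acos c) by rewrite acosK.
pose p := cos b; pose q := sin b.
have pq1 : p ^+ 2 + q ^+ 2 = 1 by rewrite cos2Dsin2.
have cpq : c = p ^+ 3 - 3 * p * q ^+ 2.
  by rewrite cE bE !cosD !sinD -/p -/q; ring.
have spq : s = 3 * p ^+ 2 * q - q ^+ 3.
  by rewrite sE bE !sinD !cosD -/p -/q; ring.
pose r : R := Num.sqrt 3.
have r2 : r ^+ 2 = 3 by rewrite sqr_sqrtr.
pose P (p q : R) :=
  p ^+ 3 * a3 + 3 * (p ^+ 2 * q * a2) + 3 * (p * q ^+ 2 * a1) + q ^+ 3 * a0.
pose W (p q : R) := (3 * p ^+ 2 - q ^+ 2) ^+ 2 / 9.
(* With r = sqrt 3, the pairs (p1, q1) and (p2, q2) are the cosine and sine of b + pi / 3 and b + 2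
   pi / 3. *)
pose p1 := p / 2 - r * q / 2; pose q1 := q / 2 + r * p / 2.
pose p2 := - p / 2 - r * q / 2; pose q2 := - q / 2 + r * p / 2.
have pq11 : p1 ^+ 2 + q1 ^+ 2 = 1.
  transitivity ((1 + r ^+ 2) / 4 * (p ^+ 2 + q ^+ 2)); first by rewrite /p1 /q1; field.
  by rewrite r2 pq1; field.
have pq21 : p2 ^+ 2 + q2 ^+ 2 = 1.
  transitivity ((1 + r ^+ 2) / 4 * (p ^+ 2 + q ^+ 2)); first by rewrite /p2 /q2; field.
  by rewrite r2 pq1; field.
have W1 : W p q + W p1 q1 + W p2 q2 = 1.
  have r4 : r ^+ 4 = 9 by rewrite (exprM _ 2 2) r2; ring.
  transitivity ((p ^+ 2 + q ^+ 2) ^+ 2); last by rewrite pq1 expr1n.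
  by rewrite /W /p1 /q1 /p2 /q2; field: r2 r4.
(* The signs alternate because 3 (b + k pi / 3) = 3b + k pi; they disappear in absolute values. *)
have E : c * a3 + s * a2 = W p q * P p q - W p1 q1 * P p1 q1 + W p2 q2 * P p2 q2.
  have r3 : r ^+ 3 = 3 * r by rewrite exprS r2 mulrC.
  have r4 : r ^+ 4 = 9 by rewrite (exprM _ 2 2) r2; ring.
  have r5 : r ^+ 5 = 9 * r by rewrite exprS r4 mulrC.
  have r6 : r ^+ 6 = 27 by rewrite (exprM _ 2 3) r2; ring.
  have r7 : r ^+ 7 = 27 * r by rewrite exprS r6 mulrC.
  transitivity ((p ^+ 2 + q ^+ 2) ^+ 2 * (c * a3 + s * a2)).
    by rewrite pq1 expr1n mul1r.
  by rewrite cpq spq /W /P /p1 /q1 /p2 /q2; field: r2 r3 r4 r5 r6 r7.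
have W_ge0 x y : 0 <= W x y by rewrite divr_ge0// sqr_ge0.
rewrite E -[leRHS]mul1r -W1 !mulrDl.
apply: (le_trans (ler_normD _ _)); rewrite lerD//; last first.
  by rewrite normrM ger0_norm// ler_wpM2l// boundM.
apply: (le_trans (ler_normB _ _)); rewrite lerD//;
  by rewrite normrM ger0_norm// ler_wpM2l// boundM.
Qed.

Section InnerProduct.
Context {R : realType} {V : lmodType R}.
Variable B : V -> V -> R.
Hypothesis BC : forall u v, B u v = B v u.
Hypothesis BP : forall (a b : R) u v w, B (a *: u + b *: v) w = a * B u w + b * B v w.
Hypothesis B_gt0 : forall u, u != 0 -> 0 < B u u.
Implicit Types u v w h : V.

Let nrm u := Num.sqrt (B u u).

Let B0l u : B 0 u = 0.
Proof. by have := BP 0 0 u u u; rewrite !scale0r addr0 !mul0r addr0. Qed.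

Lemma inner_ge0 u : 0 <= B u u.
Proof. by have [->|/B_gt0/ltW//] := eqVneq u 0; rewrite B0l. Qed.

Lemma inner_eq0 u : B u u = 0 -> u = 0.
Proof. by move=> E; apply/eqP/negPn/negP => /B_gt0; rewrite E ltxx. Qed.

Let nrm_sqr u : nrm u ^+ 2 = B u u.
Proof. by rewrite sqr_sqrtr// inner_ge0. Qed.

Lemma inner_sqrP (a b : R) u v :
  B (a *: u + b *: v) (a *: u + b *: v) =
  a ^+ 2 * B u u + 2 * a * b * B u v + b ^+ 2 * B v v.
Proof.
by rewrite BP !(BC _ (_ + _)) !BP (BC v u); ring.
Qed.

Lemma inner_schwarz u v : B u v ^+ 2 <= B u u * B v v.
Proof.
have [u0|u_neq0] := eqVneq u 0; first by rewrite u0 !B0l expr0n mul0r.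
(* The value of the form at this vector is [B u u] times the Schwarz deficit
   [B u u * B v v - B u v ^+ 2]. *)
have := inner_ge0 (B u u *: v + (- B u v) *: u).
rewrite inner_sqrP (BC v u) => H.
have Bu := B_gt0 u u_neq0.
rewrite -subr_ge0 -(pmulr_rge0 _ Bu).
by move: H; congr (0 <= _); ring.
Qed.

Lemma inner_le u v : B u v <= nrm u * nrm v.
Proof.
rewrite /nrm -sqrtrM ?inner_ge0// (le_trans (ler_norm _))//.
by rewrite -sqrtr_sqr ler_sqrt ?inner_schwarz// mulr_ge0// inner_ge0.
Qed.

Lemma inner_normD u v : nrm (u + v) <= nrm u + nrm v.
Proof.
rewrite -(ler_pXn2r (n := 2))// ?nnegrE ?sqrtr_ge0 ?addr_ge0 ?sqrtr_ge0//.
rewrite nrm_sqr -[u]scale1r -[v]scale1r inner_sqrP !scale1r sqrrD !nrm_sqr.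
by have := inner_le u v; rewrite /nrm; lra.
Qed.

Lemma inner_normN u : nrm (- u) = nrm u.
Proof.
have := inner_sqrP (-1) 0 u u; rewrite !scale0r addr0 scaleN1r /nrm => ->.
by congr Num.sqrt; ring.
Qed.

(* Banach's theorem: the norm of a symmetric trilinear form on a Euclidean space is
   attained on the diagonal.  Only the plane spanned by [h] and [u] matters. *)
Lemma trilinear_polar (T : V -> V -> V -> R) (M : R) h u :
  (forall u v w, T u v w = T v u w) -> (forall u v w, T u v w = T u w v) ->
  (forall (a b : R) u v w z,
     T (a *: u + b *: v) w z = a * T u w z + b * T v w z) ->
  (forall w, `|T w w w| <= M * nrm w ^+ 3) ->
  `|T h u u| <= M * nrm h * B u u.
Proof.
move=> T12 T23 TP Tdiag.
have T0 w z : T 0 w z = 0.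
  by have := TP 0 0 w w w z; rewrite !scale0r addr0 !mul0r addr0.
have [->|u0] := eqVneq u 0; first by rewrite T12 T0 B0l mulr0 normr0.
have [->|h0] := eqVneq h 0.
  by rewrite T0 /nrm B0l sqrtr0 mulr0 mul0r normr0.
have a0 : 0 < nrm u by rewrite sqrtr_gt0 B_gt0.
have b0 : 0 < nrm h by rewrite sqrtr_gt0 B_gt0.
pose u' := (nrm u)^-1 *: u; pose h' := (nrm h)^-1 *: h.
have uE : u = nrm u *: u' by rewrite scalerA divff ?scale1r// gt_eqF.
have hE : h = nrm h *: h' by rewrite scalerA divff ?scale1r// gt_eqF.
have TZ (a : R) x y z : T (a *: x) y z = a * T x y z.
  by have := TP a 0 x 0 y z; rewrite scaler0 addr0 mul0r addr0.
have TZ2 (a : R) x y z : T x (a *: y) z = a * T x y z by rewrite T12 TZ T12.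
have TZ3 (a : R) x y z : T x y (a *: z) = a * T x y z by rewrite T23 TZ2 T23.
have BZ (a : R) x y : B (a *: x) y = a * B x y.
  by have := BP a 0 x 0 y; rewrite scaler0 addr0 mul0r addr0.
have Bu1 : B u' u' = 1.
  by rewrite BZ BC BZ -nrm_sqr; field; rewrite lt0r_neq0.
have Bh1 : B h' h' = 1.
  by rewrite BZ BC BZ -nrm_sqr; field; rewrite lt0r_neq0.
suff main : `|T h' u' u'| <= M.
  have -> : T h u u = nrm h * nrm u ^+ 2 * T h' u' u'.
    by rewrite {1}hE {1 2}uE TZ TZ2 TZ3; ring.
  have k0 : 0 <= nrm h * nrm u ^+ 2 by rewrite mulr_ge0 ?sqr_ge0 ?ltW.
  by rewrite normrM ger0_norm// -nrm_sqr -[leRHS]mulrA mulrC ler_wpM2r.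
(* Gram-Schmidt: [d] is the part of [h'] orthogonal to [u']. Its length is [s], so (c, s) is a unit
   vector. *)
pose c := B u' h'; pose d := h' + (- c) *: u'.
have dd : B d d = 1 - c ^+ 2.
  by rewrite /d -[h']scale1r inner_sqrP Bh1 Bu1 (BC h') -/c; ring.
have hd : h' = c *: u' + d by rewrite /d scaleNr addrC subrK.
have Mu : `|T u' u' u'| <= M.
  by have := Tdiag u'; rewrite /nrm Bu1 sqrtr1 expr1n mulr1.
pose s := Num.sqrt (1 - c ^+ 2).
have s2 : s ^+ 2 = 1 - c ^+ 2 by rewrite sqr_sqrtr// -dd inner_ge0.
have [s0|s_neq0] := eqVneq s 0.
  have d0 : d = 0 by apply: inner_eq0; rewrite dd -s2 s0 expr0n.
  have c1 : `|c| = 1.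
    apply/eqP; rewrite -sqr_norm_eq1; apply/eqP.
    by move: s2; rewrite s0 expr0n/=; lra.
  by rewrite hd d0 addr0 TZ normrM c1 mul1r.
pose e := s^-1 *: d.
have dE : d = s *: e by rewrite scalerA divff ?scale1r.
have Bee : B e e = 1.
  by rewrite /e BZ BC BZ dd -s2; field.
have Bue : B u' e = 0.
  by rewrite BC /e BZ /d -[h']scale1r BP Bu1 BC -/c; ring.
rewrite hd dE TP.
(* The goal is now a combination of the two leading coefficients of the cubic form w |-> T w w w in
   the orthonormal basis (u', e). *)
apply: (@cubic_form_polar _ _ _ (T e e u') (T e e e)); last 2 first.
- exact: sqrtr_ge0.
- by rewrite s2; ring.
move=> p q pq1.
have := Tdiag (p *: u' + q *: e).
rewrite /nrm inner_sqrP Bu1 Bue Bee !mulr0 !mulr1 addr0 pq1 sqrtr1 expr1n mulr1.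
congr (`| _ | <= _).
have TP2 a b x y z w : T x (a *: y + b *: z) w = a * T x y w + b * T x z w.
  by rewrite T12 TP !(T12 _ x).
have TP3 a b x y z w : T x y (a *: z + b *: w) = a * T x y z + b * T x y w.
  by rewrite T23 TP2 !(T23 x _ y).
rewrite TP !TP2 !TP3 (T12 u' e) (T23 u' u' e) (T12 u' e u') (T23 e u' e) (T12 u' e e).
by rewrite (T23 e u' e); ring.
Qed.

End InnerProduct.

(** * Derivatives of a self-concordant function *)

Section SelfConcordant.
Context {R : realType} {n : nat}.
Local Notation V := 'cV[R]_n.
Context {D : set V} {f : V -> R}.
Hypothesis scf : self_concordant D f.
Hypothesis hess_gt0 : forall y, D y -> posdef (hess f y).
Implicit Types x y u v w : V.

Lemma sc_segment x y (a : R) : D x -> D y -> 0 <= a <= 1 -> D (x + a *: (y - x)).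
Proof.
move=> Dx Dy /andP[a0 a1].
have := sc_convex_dom scf (Itv01 a0 a1) (mem_set Dy) (mem_set Dx).
rewrite inE; congr D.
change (a *: y + (1 - a) *: x = x + a *: (y - x)).
by rewrite scalerBl scale1r scalerBr addrCA.
Qed.

Lemma sc_nbhs x : D x -> nbhs x D.
Proof. by move=> Dx; apply: open_nbhs_nbhs; split => //; exact: sc_open scf. Qed.

Lemma sc_diff1 x : D x -> differentiable f x.
Proof. by have [+ _] := sc_C3 scf; apply. Qed.

Lemma sc_diff2 v x : D x -> differentiable ('D_v f) x.
Proof. by have [_ /(_ v)[+ _]] := sc_C3 scf; apply. Qed.

Lemma sc_diff3 u v x : D x -> differentiable ('D_u ('D_v f)) x.
Proof. by have [_ /(_ v)[_ /(_ u)[+ _]]] := sc_C3 scf; apply. Qed.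

Lemma sc_cont3 u v w x : D x -> {for x, continuous ('D_u ('D_v ('D_w f)))}.
Proof. by have [_ /(_ w)[_ /(_ v)[_ /(_ u)+]]] := sc_C3 scf; apply. Qed.

Lemma sc_derive2C u v x : D x -> 'D_u ('D_v f) x = 'D_v ('D_u f) x.
Proof.
move=> Dx; apply: (derive_sym D) => //; first exact: sc_open scf.
- exact: sc_diff1.
- exact: sc_diff2.
- by move=> w w'; apply: differentiable_continuous; exact: sc_diff3.
Qed.

Lemma sc_derive2P (a b : R) u v w x : D x ->
  'D_(a *: u + b *: v) ('D_w f) x = a * 'D_u ('D_w f) x + b * 'D_v ('D_w f) x.
Proof.
by move=> Dx; rewrite derive_dirD ?derive_dirZ//; exact: sc_diff2.
Qed.

Lemma sc_derive2Z (a : R) u x : D x ->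
  'D_(a *: u) ('D_(a *: u) f) x = a ^+ 2 * 'D_u ('D_u f) x.
Proof.
move=> Dx; rewrite derive_dirZ; last exact: sc_diff2.
rewrite (sc_derive2C u (a *: u) x Dx) derive_dirZ; last exact: sc_diff2.
by rewrite mulrA -expr2.
Qed.

Lemma sc_derive3C12 u v w x : D x ->
  'D_u ('D_v ('D_w f)) x = 'D_v ('D_u ('D_w f)) x.
Proof.
move=> Dx; apply: (derive_sym D) => //; first exact: sc_open scf.
- exact: sc_diff2.
- by move=> ? ? ?; exact: sc_diff3.
- by move=> ? ?; exact: sc_cont3.
Qed.

Lemma sc_derive3C23 u v w x : D x ->
  'D_u ('D_v ('D_w f)) x = 'D_u ('D_w ('D_v f)) x.
Proof.
move=> Dx; apply: near_eq_derive; apply: filterS (sc_nbhs _ Dx) => y.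
exact: sc_derive2C.
Qed.

Lemma sc_derive3P (a b : R) u v w z x : D x ->
  'D_(a *: u + b *: v) ('D_w ('D_z f)) x =
  a * 'D_u ('D_w ('D_z f)) x + b * 'D_v ('D_w ('D_z f)) x.
Proof.
by move=> Dx; rewrite derive_dirD ?derive_dirZ//; exact: sc_diff3.
Qed.

(** With [dot_hess], this translates the coordinate definitions of gradient and Hessian into the
    directional derivatives used everywhere below. *)
Lemma dot_grad x u : D x -> dot (grad f x) u = 'D_u f x.
Proof.
move=> Dx; rewrite /dot mxE deriveE; last exact: sc_diff1.
rewrite [u in RHS]matrix_sum_delta linear_sum; apply: eq_bigr => i _.
rewrite big_ord1 linearZ !mxE mulrC deriveE//; exact: sc_diff1.
Qed.

Lemma dot_hess x u v : D x -> dot u (hess f x *m v) = 'D_u ('D_v f) x.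
Proof.
move=> Dx; rewrite /dot mxE deriveE; last exact: sc_diff2.
rewrite [u in RHS]matrix_sum_delta linear_sum; apply: eq_bigr => i _.
rewrite big_ord1 linearZ !mxE; congr (_ * _).
rewrite -deriveE; last exact: sc_diff2.
rewrite sc_derive2C// deriveE; last exact: sc_diff2.
rewrite [v in RHS]matrix_sum_delta linear_sum; apply: eq_bigr => j _.
rewrite big_ord1 linearZ !mxE -deriveE; last exact: sc_diff2.
by rewrite sc_derive2C// mulrC.
Qed.

Lemma local_normE x u : D x -> local_norm f x u = Num.sqrt ('D_u ('D_u f) x).
Proof. by move=> Dx; rewrite /local_norm dot_hess. Qed.

Lemma sc_derive2_gt0 x u : D x -> u != 0 -> 0 < 'D_u ('D_u f) x.
Proof. by move=> Dx u0; rewrite -dot_hess// hess_gt0. Qed.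

Lemma sc_derive2_ge0 x u : D x -> 0 <= 'D_u ('D_u f) x.
Proof.
move=> Dx; apply: (@inner_ge0 _ _ (fun u v => 'D_u ('D_v f) x)) => *;
  [exact: sc_derive2P|exact: sc_derive2_gt0].
Qed.

Lemma local_norm_ge0 x u : 0 <= local_norm f x u.
Proof. exact: sqrtr_ge0. Qed.

Lemma local_norm_sqr x u : D x -> local_norm f x u ^+ 2 = 'D_u ('D_u f) x.
Proof. by move=> Dx; rewrite local_normE// sqr_sqrtr// sc_derive2_ge0. Qed.

Lemma local_norm_gt0 x u : D x -> u != 0 -> 0 < local_norm f x u.
Proof. by move=> Dx u0; rewrite local_normE// sqrtr_gt0 sc_derive2_gt0. Qed.

Lemma local_norm0 x : local_norm f x 0 = 0.
Proof. by rewrite /local_norm mulmx0 /dot mulmx0 mxE sqrtr0. Qed.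

Lemma local_normN x u : D x -> local_norm f x (- u) = local_norm f x u.
Proof.
move=> Dx; rewrite !(local_normE _ _ Dx); pose B u v := 'D_u ('D_v f) x.
by apply: (@inner_normN _ _ B _ _ u) => *; [exact: sc_derive2C|exact: sc_derive2P].
Qed.

Lemma local_normD x u v : D x ->
  local_norm f x (u + v) <= local_norm f x u + local_norm f x v.
Proof.
move=> Dx; rewrite !(local_normE _ _ Dx); pose B u v := 'D_u ('D_v f) x.
by apply: (@inner_normD _ _ B _ _ _ u v) => *;
  [exact: sc_derive2C|exact: sc_derive2P|exact: sc_derive2_gt0].
Qed.

Lemma line_nbhs x v (tau : R) : D (x + tau *: v) ->
  \forall s \near tau, D (x + s *: v).
Proof.
move=> /sc_nbhs; apply: (_ : {for tau, continuous (fun s : R => x + s *: v)}).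
by apply: cvgD; [exact: cvg_cst|exact: scalel_continuous].
Qed.

Lemma derive1_line x v (tau : R) (h : V -> R) : derivable h (x + tau *: v) v ->
  derive1 (fun s : R => h (x + s *: v)) tau = 'D_v h (x + tau *: v).
Proof. by move=> dh; rewrite derive1E; have [] := is_derive_line h x v tau dh. Qed.

Lemma derive2_line x v (tau : R) : D (x + tau *: v) ->
  derive1n 2 (fun s : R => f (x + s *: v)) tau = 'D_v ('D_v f) (x + tau *: v).
Proof.
move=> Dx; rewrite derive1nS derive1n1 derive1E.
rewrite (_ : 'D_v ('D_v f) _ = derive1 (fun s : R => 'D_v f (x + s *: v)) tau); last first.
  by rewrite (derive1_line x v tau ('D_v f))//; apply/diff_derivable/sc_diff2.
rewrite derive1E; apply: near_eq_derive; apply: filterS (line_nbhs _ _ _ Dx) => s Ds.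
by rewrite (derive1_line x v s f)//; apply/diff_derivable/sc_diff1.
Qed.

(** Self-concordance of the restriction to the line through [x] with direction [w], read at
    parameter 0; the power 3/2 becomes the cube of a square root. *)
Lemma sc_derive3_diag x w : D x ->
  `|'D_w ('D_w ('D_w f)) x| <= 2 * local_norm f x w ^+ 3.
Proof.
move=> Dx.
have Dx0 : D (x + 0 *: w) by rewrite scale0r addr0.
have [_ /(_ 0 Dx0)] := sc_line scf w Dx.
rewrite derive2_line// derive1nS derive1E.
rewrite (near_eq_derive (g := fun s : R => 'D_w ('D_w f) (x + s *: w))); last first.
  by apply: filterS (line_nbhs _ _ _ Dx0) => s; exact: derive2_line.
rewrite -derive1E (derive1_line x w 0 ('D_w ('D_w f))); last exact/diff_derivable/sc_diff3.
rewrite scale0r addr0 => /le_trans; apply; rewrite mulrC [leRHS]mulrC ler_pM2r//.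
rewrite (_ : 3 / 2 = 2^-1 * 3%:R); last by rewrite mulrC.
by rewrite powRrM powR12_sqrt ?sc_derive2_ge0// powR_mulrn ?sqrtr_ge0// -local_normE.
Qed.

(** Banach's theorem for the third derivative, in the inner product given by the Hessian at [x]:
    passing from the diagonal to mixed directions keeps the constant 2. *)
Lemma sc_derive3_le x h u : D x ->
  `|'D_h ('D_u ('D_u f)) x| <= 2 * local_norm f x h * 'D_u ('D_u f) x.
Proof.
move=> Dx; rewrite local_normE//.
apply: (@trilinear_polar _ _ (fun u v => 'D_u ('D_v f) x) _ _ _
  (fun u v w => 'D_u ('D_v ('D_w f)) x)) => *.
- exact: sc_derive2C.
- exact: sc_derive2P.
- exact: sc_derive2_gt0.
- exact: sc_derive3C12.
- exact: sc_derive3C23.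
- exact: sc_derive3P.
- by rewrite -local_normE// sc_derive3_diag.
Qed.

End SelfConcordant.

(** * Estimates along segments *)

#[local] Opaque local_norm derive.

Section Segments.
Context {R : realType} {n : nat}.
Local Notation V := 'cV[R]_n.
Context {D : set V} {f : V -> R}.
Hypothesis scf : self_concordant D f.
Hypothesis hess_gt0 : forall y, D y -> posdef (hess f y).
Implicit Types x y u v w : V.

Lemma local_normZ x (a : R) u : D x -> 0 <= a ->
  local_norm f x (a *: u) = a * local_norm f x u.
Proof.
move=> Dx a0; rewrite !(local_normE scf)//.
rewrite (sc_derive2Z scf a u x Dx).
by rewrite sqrtrM ?sqr_ge0// sqrtr_sqr ger0_norm.
Qed.

Lemma is_derive_affine (r s : R) :
  is_derive s (1 : R) (fun s : R => 1 - s * r) (- r).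
Proof.
have ds : is_derive s (1 : R) ((cst (1 : R) : R -> R) - ((id : R -> R) * (cst r : R -> R)))
    (0 - (s *: (0 : R) + r *: (1 : R))).
  exact: is_deriveB.
by apply: (is_derive_eq ds); rewrite scaler0 !add0r; congr (- _); exact: mulr1.
Qed.

Lemma is_derive_affineV (r s : R) : 1 - s * r != 0 ->
  is_derive s (1 : R) (fun s => (1 - s * r)^-1) (r * (1 - s * r) ^- 2).
Proof.
move=> sr0; apply: (is_derive_eq (@is_deriveV _ _ s _ 1 sr0 (is_derive_affine r s))).
by rewrite scaleNr scalerN opprK [LHS]mulrC.
Qed.

Lemma is_derive_line1 x v s : D (x + s *: v) ->
  is_derive s (1 : R) (fun s => f (x + s *: v)) ('D_v f (x + s *: v)).
Proof. by move=> Dx; apply/is_derive_line/diff_derivable/(sc_diff1 scf). Qed.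

Lemma is_derive_line2 x u v s : D (x + s *: v) ->
  is_derive s (1 : R) (fun s => 'D_u f (x + s *: v)) ('D_v ('D_u f) (x + s *: v)).
Proof.
by move=> Dx; apply: (@is_derive_line _ _ ('D_u f)); apply/diff_derivable/(sc_diff2 scf).
Qed.

Lemma is_derive_line3 x u w v s : D (x + s *: v) ->
  is_derive s (1 : R) (fun s => 'D_u ('D_w f) (x + s *: v))
    ('D_v ('D_u ('D_w f)) (x + s *: v)).
Proof.
by move=> Dx; apply: (@is_derive_line _ _ ('D_u ('D_w f))); apply/diff_derivable/(sc_diff3 scf).
Qed.

(** With q the second derivative along the line, q^(-1/2) has derivative -q' / (2 q^(3/2)), and
    self-concordance says exactly that this is at most 1 in absolute value. *)
Lemma inv_local_norm_line x v (T : R) : 0 <= T -> v != 0 ->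
  (forall s, 0 <= s <= T -> D (x + s *: v)) ->
  `|(local_norm f (x + T *: v) v)^-1 - (local_norm f x v)^-1| <= T.
Proof.
move=> T0 v0 DT.
pose q s := 'D_v ('D_v f) (x + s *: v).
pose q' s := 'D_v ('D_v ('D_v f)) (x + s *: v).
pose g s := (Num.sqrt (q s))^-1.
pose g' s := - (q' s / 2) * (Num.sqrt (q s)) ^- 3.
have q0 s : 0 <= s <= T -> 0 < q s by move=> sT; apply: (sc_derive2_gt0 scf) => //; exact: DT.
have dg s : 0 <= s <= T -> is_derive s (1 : R) g (g' s).
  move=> sT; have sq0 : Num.sqrt (q s) != 0 by rewrite gt_eqF// sqrtr_gt0 q0.
  have dq : is_derive s (1 : R) q (q' s) by apply: is_derive_line3; exact: DT.
  have dsq := is_derive1_comp (is_derive1_sqrt (q0 _ sT)) dq.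
  apply: (is_derive_eq (@is_deriveV _ _ s _ 1 sq0 dsq)).
  rewrite /g' /=; move: sq0; move: (Num.sqrt (q s)) (q' s) => a b a0.
  by rewrite -[LHS]/(_ * _); field.
have g1 s : 0 <= s <= T -> `|g' s| <= 1.
  move=> sT; have Ds := DT _ sT; have := sc_derive3_diag scf hess_gt0 _ v Ds.
  rewrite (local_normE scf)// -/(q s) -/(q' s) => H.
  have s3 : 0 < Num.sqrt (q s) ^+ 3 by rewrite exprn_gt0// sqrtr_gt0 q0.
  rewrite /g' normrM normrN normfV (gtr0_norm s3) ler_pdivrMr// mul1r.
  by rewrite normrM normfV (ger0_norm (_ : 0 <= 2))// ler_pdivrMr// mulrC.
have proper_fineE s : 0 <= s <= T -> (local_norm f (x + s *: v) v)^-1 = g s.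
  by move=> sT; rewrite (local_normE scf)//; exact: DT.
have TT : 0 <= T <= T by rewrite T0 lexx.
have zT : 0 <= (0 : R) <= T by rewrite T0 lexx.
suff: `|g T - g 0| <= T.
  by rewrite -(proper_fineE T TT) -(proper_fineE 0 zT) scale0r addr0.
apply/ler_normlP; split.
  have : g 0 + 0 <= g T + T.
    apply: (@derive_nondecreasing R (g + id) (fun s => g' s + 1) 0 T T0) => s sT.
      by apply: is_deriveD; exact: dg.
    by have /ler_normlP[/= gs _] := g1 _ sT; lra.
  by move: (g 0) (g T) => a b H; lra.
have : T - g T >= 0 - g 0.
  apply: (@derive_nondecreasing R (fun s => s - g s) (fun s => 1 - g' s) 0 T T0) => s sT.
    by apply: is_deriveB; exact: dg.
  by have /ler_normlP[_ /= gs] := g1 _ sT; lra.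
by move: (g 0) (g T) => a b H; lra.
Qed.

Lemma local_norm_line_ge x v (T : R) : 0 <= T ->
  (forall s, 0 <= s <= T -> D (x + s *: v)) ->
  local_norm f x v <= (1 + T * local_norm f x v) * local_norm f (x + T *: v) v.
Proof.
move=> T0 DT; have [->|v0] := eqVneq v 0.
  by rewrite !local_norm0 mulr0.
have := inv_local_norm_line _ _ _ T0 v0 DT.
have a0 : 0 < local_norm f x v.
  by apply: (local_norm_gt0 scf) => //; rewrite -[x]addr0 -(scale0r v); apply: DT; rewrite lexx.
have b0 : 0 < local_norm f (x + T *: v) v.
  by apply: (local_norm_gt0 scf) => //; apply: DT; rewrite lexx T0.
move=> /ler_normlP[_]; move: a0 b0;
move: (local_norm f x v) (local_norm f (x + T *: v) v) => a b a0 b0.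
rewrite -(ler_pM2l (mulr_gt0 a0 b0)).
have -> : a * b * (b^-1 - a^-1) = a - b by field; rewrite (gt_eqF a0) (gt_eqF b0).
by lra.
Qed.

(** Multiplied out, the bound needs no condition on [T]: it is trivial once the factor
    [1 - T * local_norm f x v] is not positive. *)
Lemma local_norm_line_le x v (T : R) : 0 <= T ->
  (forall s, 0 <= s <= T -> D (x + s *: v)) ->
  (1 - T * local_norm f x v) * local_norm f (x + T *: v) v <= local_norm f x v.
Proof.
move=> T0 DT; have [->|v0] := eqVneq v 0.
  by rewrite !local_norm0 mulr0.
have := inv_local_norm_line _ _ _ T0 v0 DT.
have a0 : 0 < local_norm f x v.
  by apply: (local_norm_gt0 scf) => //; rewrite -[x]addr0 -(scale0r v); apply: DT; rewrite lexx.
have b0 : 0 < local_norm f (x + T *: v) v.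
  by apply: (local_norm_gt0 scf) => //; apply: DT; rewrite lexx T0.
move=> /ler_normlP[+ _]; move: a0 b0;
move: (local_norm f x v) (local_norm f (x + T *: v) v) => a b a0 b0.
rewrite -(ler_pM2l (mulr_gt0 a0 b0)).
have -> : a * b * - (b^-1 - a^-1) = b - a by field; rewrite (gt_eqF a0) (gt_eqF b0).
by lra.
Qed.

End Segments.

(** * Comparison of Hessians along a segment *)

Lemma ler_of_sqrM {R : realDomainType} (a b c : R) : 0 <= c -> 0 <= a -> 0 <= b ->
  c ^+ 2 * a ^+ 2 <= b ^+ 2 -> c * a <= b.
Proof. by move=> c0 a0 b0; rewrite -exprMn ler_pXn2r// nnegrE mulr_ge0. Qed.

Lemma ler_mul_invM {R : realFieldType} (a b c : R) : 0 < c ->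
  a <= b * (c^-1 * c^-1) -> c ^+ 2 * a <= b.
Proof. by move=> c0; rewrite -invfM -expr2 ler_pdivlMr ?exprn_gt0// mulrC. Qed.

Section Estimates.
Context {R : realType} {n : nat}.
Local Notation V := 'cV[R]_n.
Context {D : set V} {f : V -> R}.
Hypothesis scf : self_concordant D f.
Hypothesis hess_gt0 : forall y, D y -> posdef (hess f y).
Implicit Types x y u v w : V.

(** With m(s) the second derivative in direction [u] at [x + s *: v], the product (1 - s r)^2 m(s)
    does not increase: |m'| <= 2 N m by Banach's theorem, where the local length N of [v] is at most
    r / (1 - s r). *)
Lemma hess_line_le x v u (T : R) : 0 <= T -> T * local_norm f x v < 1 ->
  (forall s, 0 <= s <= T -> D (x + s *: v)) ->
  (1 - T * local_norm f x v) * local_norm f (x + T *: v) u <= local_norm f x u.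
Proof.
move=> T0 + DT; move rE : (local_norm f x v) => r Tr.
have r0 : 0 <= r by rewrite -rE local_norm_ge0.
have sr1 s : 0 <= s <= T -> 0 < 1 - s * r.
  by move=> /andP[_ sT]; have := ler_wpM2r r0 sT; lra.
pose m s := 'D_u ('D_u f) (x + s *: v).
pose m' s := 'D_v ('D_u ('D_u f)) (x + s *: v).
have dm s : 0 <= s <= T -> is_derive s (1 : R) m (m' s).
  by move=> sT; apply: (is_derive_line3 scf); exact: DT.
have dw s : is_derive s (1 : R) (fun s : R => 1 - s * r) (- r).
  exact: is_derive_affine.
pose G s := - (m s * ((1 - s * r) * (1 - s * r))).
pose G' s := - (m s * (2 * (1 - s * r) * - r) + (1 - s * r) * (1 - s * r) * m' s).
have dG s : 0 <= s <= T -> is_derive s (1 : R) G (G' s).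
  move=> sT; have dG := is_deriveN (is_deriveM (dm _ sT) (is_deriveM (dw s) (dw s))).
  apply: (is_derive_eq dG); rewrite /G' /=; move: (m s) (m' s) => a b.
  rewrite -[LHS]/(- (a * ((1 - s * r) * - r + (1 - s * r) * - r) + (1 - s * r) * (1 - s * r) * b)).
  by ring.
have G'0 s : 0 <= s <= T -> 0 <= G' s.
  move=> sT; have Ds := DT _ sT.
  have := sc_derive3_le scf hess_gt0 (x + s *: v) v u Ds.
  have ms0 : 0 <= m s by exact: (sc_derive2_ge0 scf hess_gt0).
  have := @local_norm_line_le _ _ _ _ scf hess_gt0 x v s.
  have := sr1 _ sT; have N0 := local_norm_ge0 (f := f) (x + s *: v) v.
  have [s0 sT'] := andP sT.
  rewrite rE /G' -/(m s) -/(m' s); move: (local_norm f (x + s *: v) v) (m s) (m' s) N0 ms0.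
  move=> N a b N0 a0 w0 H /ler_normlP[_ Hb].
  have {H} H : (1 - s * r) * N <= r.
    by apply: H => // s' /andP[? ?]; apply: DT; rewrite (le_trans _ sT') ?andbT.
  rewrite oppr_ge0; move: w0 H; move: (1 - s * r) => w w0 H.
  have H1 : w * w * b <= w * w * (2 * N * a) by rewrite ler_wpM2l// mulr_ge0// ltW.
  have H2 : 2 * w * a * (w * N) <= 2 * w * a * r.
    by apply: ler_wpM2l => //; apply: mulr_ge0 => //; apply: mulr_ge0 => //; exact: ltW.
  by nra.
have G0T := @derive_nondecreasing R G G' 0 T T0 dG G'0.
have D0 : D x by rewrite -[x]addr0 -(scale0r v); apply: DT; rewrite lexx T0.
have DxT : D (x + T *: v) by apply: DT; rewrite lexx T0.
have w0 : 0 <= 1 - T * r by rewrite ltW// sr1// T0 lexx.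
have m0E : m 0 = 'D_u ('D_u f) x by rewrite /m scale0r addr0.
have : (1 - T * r) ^+ 2 * m T <= m 0.
  by move: G0T; rewrite /G; move: (m 0) (m T) => a b; lra.
move: DxT; rewrite m0E /m; move: (x + T *: v) => y Dy.
rewrite -(local_norm_sqr scf hess_gt0 x u D0) -(local_norm_sqr scf hess_gt0 y u Dy).
move: (local_norm_ge0 (f := f) x u) (local_norm_ge0 (f := f) y u).
move: (local_norm f x u) (local_norm f y u) => a b a0 b0.
exact: (ler_of_sqrM _ _ _ w0 b0 a0).
Qed.

(** The same argument from below: m(s) / (1 - s r)^2 does not decrease. *)
Lemma hess_line_ge x v u (T : R) : 0 <= T -> T * local_norm f x v < 1 ->
  (forall s, 0 <= s <= T -> D (x + s *: v)) ->
  (1 - T * local_norm f x v) * local_norm f x u <= local_norm f (x + T *: v) u.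
Proof.
move=> T0 + DT; move rE : (local_norm f x v) => r Tr.
have r0 : 0 <= r by rewrite -rE local_norm_ge0.
have sr1 s : 0 <= s <= T -> 0 < 1 - s * r.
  by move=> /andP[_ sT]; have := ler_wpM2r r0 sT; lra.
pose m s := 'D_u ('D_u f) (x + s *: v).
pose m' s := 'D_v ('D_u ('D_u f)) (x + s *: v).
have dm s : 0 <= s <= T -> is_derive s (1 : R) m (m' s).
  by move=> sT; apply: (is_derive_line3 scf); exact: DT.
pose w s := (1 - s * r)^-1.
have dw s : 0 <= s <= T -> is_derive s (1 : R) w (r * w s ^+ 2).
  move=> sT; rewrite /w exprVn; apply: is_derive_affineV.
  by rewrite gt_eqF// sr1.
pose G s := m s * (w s * w s).
pose G' s := m s * (2 * w s * (r * w s ^+ 2)) + w s * w s * m' s.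
have dG s : 0 <= s <= T -> is_derive s (1 : R) G (G' s).
  move=> sT; have dG := is_deriveM (dm _ sT) (is_deriveM (dw _ sT) (dw _ sT)).
  apply: (is_derive_eq dG); rewrite /G'.
  rewrite -[LHS]/(m s * (w s * (r * w s ^+ 2) + w s * (r * w s ^+ 2)) + w s * w s * m' s).
  by move: (m s) (m' s) (w s) => a b c; ring.
have G'0 s : 0 <= s <= T -> 0 <= G' s.
  move=> sT; have Ds := DT _ sT.
  have := sc_derive3_le scf hess_gt0 (x + s *: v) v u Ds.
  have ms0 : 0 <= m s by exact: (sc_derive2_ge0 scf hess_gt0).
  have := @local_norm_line_le _ _ _ _ scf hess_gt0 x v s.
  have N0 := local_norm_ge0 (f := f) (x + s *: v) v.
  have [s0 sT'] := andP sT.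
  rewrite rE /G' -/(m s) -/(m' s); move: (local_norm f (x + s *: v) v) (m s) (m' s) N0 ms0.
  move=> N a b N0 a0 H /ler_normlP[Hb _].
  have {H} H : (1 - s * r) * N <= r.
    by apply: H => // s' /andP[? ?]; apply: DT; rewrite (le_trans _ sT') ?andbT.
  have w0 : 0 < w s by rewrite invr_gt0 sr1.
  have {}H : N <= r * w s by rewrite /w ler_pdivlMr ?sr1// mulrC.
  move: w0 H; move: (w s) => c c0 H.
  have H1 : c * c * - b <= c * c * (2 * N * a) by rewrite ler_wpM2l// mulr_ge0// ltW.
  have H2 : 2 * c * c * a * N <= 2 * c * c * a * (r * c).
    apply: ler_wpM2l => //; apply: mulr_ge0 => //; apply: mulr_ge0; last exact: ltW.
    by apply: mulr_ge0 => //; exact: ltW.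
  by nra.
have G0T := @derive_nondecreasing R G G' 0 T T0 dG G'0.
have D0 : D x by rewrite -[x]addr0 -(scale0r v); apply: DT; rewrite lexx T0.
have DxT : D (x + T *: v) by apply: DT; rewrite lexx T0.
have w0 : 0 < 1 - T * r by rewrite sr1// T0 lexx.
have m0E : m 0 = 'D_u ('D_u f) x by rewrite /m scale0r addr0.
have : (1 - T * r) ^+ 2 * m 0 <= m T.
  move: G0T; rewrite /G; move: (m 0) (m T) => a b; rewrite /w mul0r subr0 invr1 !mulr1.
  exact: (ler_mul_invM _ _ _ w0).
move: DxT; rewrite m0E /m; move: (x + T *: v) => y Dy.
rewrite -(local_norm_sqr scf hess_gt0 x u D0) -(local_norm_sqr scf hess_gt0 y u Dy).
move: (local_norm_ge0 (f := f) x u) (local_norm_ge0 (f := f) y u).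
move: (local_norm f x u) (local_norm f y u) => a b a0 b0.
exact: (ler_of_sqrM _ _ _ (ltW w0) a0 b0).
Qed.

End Estimates.

(** * Gradient estimates between two points *)

Lemma ler_contract {R : realFieldType} (a b : R) :
  0 <= b -> (forall c, 0 < c < 1 -> c * a <= b) -> a <= b.
Proof.
move=> b0 H; rewrite leNgt; apply/negP => ba.
have a0 : 0 < a := le_lt_trans b0 ba.
(* The factor chosen is the midpoint of b / a and 1, so its product with [a] exceeds [b]. *)
have : (1 + b / a) / 2 * a <= b.
  apply: H; rewrite divr_gt0 ?ltr_pwDl ?divr_ge0 ?(ltW a0)//=.
  rewrite ltr_pdivrMr// mul1r; have : b / a < 1 by rewrite ltr_pdivrMr// mul1r.
  by lra.
rewrite mulrAC mulrDl divfK ?gt_eqF//; lra.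
Qed.

Lemma ler_sub_swap {R : realDomainType} (a b c d : R) : a - b <= c - d -> d - b <= c - a.
Proof. by lra. Qed.

Section Estimates.
Context {R : realType} {n : nat}.
Local Notation V := 'cV[R]_n.
Context {D : set V} {f : V -> R}.
Hypothesis scf : self_concordant D f.
Hypothesis hess_gt0 : forall y, D y -> posdef (hess f y).
Implicit Types x y u v w : V.

Let seg x y (s : R) : D x -> D y -> 0 <= s <= 1 -> D (x + s *: (y - x)).
Proof. exact: (sc_segment scf). Qed.

Let seg1 x y : x + (1 : R) *: (y - x) = y.
Proof. by rewrite scale1r subrKC. Qed.

Lemma local_norm_step x y : D x -> D y ->
  (1 - local_norm f x (y - x)) * local_norm f y (y - x) <= local_norm f x (y - x).
Proof.
move=> Dx Dy.
have := local_norm_line_le scf hess_gt0 x (y - x) 1 ler01 (fun s => seg x y s Dx Dy).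
by rewrite mul1r seg1.
Qed.

Lemma hess_step x y u : D x -> D y -> local_norm f x (y - x) < 1 ->
  (1 - local_norm f x (y - x)) * local_norm f x u <= local_norm f y u.
Proof.
move=> Dx Dy r1.
have := hess_line_ge scf hess_gt0 x (y - x) u 1 ler01 _ (fun s => seg x y s Dx Dy).
by rewrite mul1r seg1; apply.
Qed.

(** The derivative of [p] is the squared local length of [y - x], at least (r / (1 + s r))^2; the
    integral of this over [0, 1] is r^2 / (1 + r). *)
Lemma grad_monotone x y : D x -> D y ->
  local_norm f x (y - x) ^+ 2 <=
  (1 + local_norm f x (y - x)) * ('D_(y - x) f y - 'D_(y - x) f x).
Proof.
move=> Dx Dy; set r := local_norm f x (y - x).
have r0 : 0 <= r := local_norm_ge0 (f := f) x (y - x).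
pose p (s : R) : R := 'D_(y - x) f (x + s *: (y - x)).
pose q (s : R) : R := 'D_(y - x) ('D_(y - x) f) (x + s *: (y - x)).
(* Written with [- r], the weight 1 / (1 + s r) has the form treated by [is_derive_affineV]. *)
pose w (s : R) : R := (1 - s * - r)^-1.
have sr1 (s : R) : 0 <= s <= 1 -> 0 < 1 - s * - r.
  by move=> /andP[s0 _]; have := mulr_ge0 s0 r0; lra.
have dp (s : R) : 0 <= s <= 1 -> is_derive s (1 : R) p (q s).
  by move=> s01; apply: (is_derive_line2 scf); exact: seg.
have dw (s : R) : 0 <= s <= 1 -> is_derive s (1 : R) w (- r * (1 - s * - r) ^- 2).
  by move=> s01; apply: is_derive_affineV; rewrite gt_eqF// sr1.
pose G (s : R) : R := p s + r * w s.
pose G' (s : R) : R := q s + r * (- r * (1 - s * - r) ^- 2).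
have dG (s : R) : 0 <= s <= 1 -> is_derive s (1 : R) G (G' s).
  by move=> s01; exact: is_deriveD (dp _ s01) (is_deriveZ r (dw _ s01)).
have G'0 (s : R) : 0 <= s <= 1 -> 0 <= G' s.
  move=> s01; have [s0 s1] := andP s01; have Ds := seg x y s Dx Dy s01.
  have : local_norm f (x + s *: (y - x)) (y - x) ^+ 2 = q s.
    exact: (local_norm_sqr scf hess_gt0).
  have := local_norm_line_ge scf hess_gt0 x (y - x) s s0.
  rewrite /G' -/r; move: (sr1 _ s01); rewrite mulrN opprK; move: (1 + s * r) => c c0.
  move: (local_norm f _ _) (q s) (local_norm_ge0 (f := f) (x + s *: (y - x)) (y - x)).
  move=> N qs N0 H <-.
  have {}H : r <= c * N.
    by apply: H => s' /andP[s'0 s's]; apply: seg => //; rewrite s'0 (le_trans s's).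
  rewrite mulNr mulrN subr_ge0 mulrA -expr2 ler_pdivrMr ?exprn_gt0//.
  by rewrite -exprMn mulrC ler_pXn2r// nnegrE mulr_ge0// ltW.
have := @derive_nondecreasing R G G' 0 1 ler01 dG G'0.
rewrite /G /p /w seg1 scale0r addr0 mul0r subr0 invr1 mulr1 mul1r opprK.
move: ('D_(y - x) f x) ('D_(y - x) f y) => a b.
have c0 : 0 < 1 + r by rewrite ltr_wpDr.
rewrite -(ler_pM2l c0) !mulrDr mulrCA mulfV ?gt_eqF//; lra.
Qed.

(** The second derivative of [p] is the third derivative of [f] in directions [w], [y - x], [y - x],
    hence at most 2 Nw r^2 / (1 - s r)^3. Two integrations give the bound. *)
Lemma grad_taylor x y w : D x -> D y -> local_norm f x (y - x) < 1 ->
  'D_w f y - 'D_w f x - 'D_(y - x) ('D_w f) x <=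
  local_norm f x (y - x) ^+ 2 / (1 - local_norm f x (y - x)) * local_norm f x w.
Proof.
move=> Dx Dy; set r := local_norm f x (y - x) => r1.
have r0 : 0 <= r := local_norm_ge0 (f := f) x (y - x).
set Nw := local_norm f x w; have Nw0 : 0 <= Nw := local_norm_ge0 (f := f) x w.
pose p (s : R) : R := 'D_w f (x + s *: (y - x)).
pose q (s : R) : R := 'D_(y - x) ('D_w f) (x + s *: (y - x)).
pose t (s : R) : R := 'D_(y - x) ('D_(y - x) ('D_w f)) (x + s *: (y - x)).
pose c (s : R) : R := (1 - s * r)^-1.
have sr1 (s : R) : 0 <= s <= 1 -> 0 < 1 - s * r.
  by move=> /andP[_ s1]; have := ler_wpM2r r0 s1; lra.
have dp (s : R) : 0 <= s <= 1 -> is_derive s (1 : R) p (q s).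
  by move=> s01; apply: (is_derive_line2 scf); exact: seg.
have dq (s : R) : 0 <= s <= 1 -> is_derive s (1 : R) q (t s).
  by move=> s01; apply: (is_derive_line3 scf); exact: seg.
have dc (s : R) : 0 <= s <= 1 -> is_derive s (1 : R) c (r * c s ^+ 2).
  move=> s01; rewrite /c exprVn; apply: is_derive_affineV.
  by rewrite gt_eqF// sr1.
(* First integration: Nw r / (1 - s r)^2 is a primitive of the bound on [t]. *)
pose G (s : R) : R := Nw * r * (c s * c s) - q s.
pose G' (s : R) : R := Nw * r * (2 * r * c s ^+ 3) - t s.
have dG (s : R) : 0 <= s <= 1 -> is_derive s (1 : R) G (G' s).
  move=> s01.
  have dG := is_deriveB (is_deriveZ (Nw * r) (is_deriveM (dc _ s01) (dc _ s01))) (dq _ s01).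
  apply: (is_derive_eq dG); rewrite /G'.
  rewrite -[LHS]/(Nw * r * (c s * (r * c s ^+ 2) + c s * (r * c s ^+ 2)) - t s).
  by move: (c s) (t s) => a b; ring.
have G'0 (s : R) : 0 <= s <= 1 -> 0 <= G' s.
  move=> s01; have [s0 s1] := andP s01; have Ds := seg x y s Dx Dy s01.
  have segs s' : 0 <= s' <= s -> D (x + s' *: (y - x)).
    by move=> /andP[s'0 s's]; apply: seg => //; rewrite s'0 (le_trans s's).
  have Nd := local_norm_line_le scf hess_gt0 x (y - x) s s0 segs.
  have Nh : (1 - s * r) * local_norm f (x + s *: (y - x)) w <= Nw.
    by apply: (hess_line_le scf hess_gt0) => //; rewrite -subr_gt0 sr1.
  have := sc_derive3_le scf hess_gt0 _ w (y - x) Ds.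
  rewrite (sc_derive3C12 scf) // (sc_derive3C23 scf) // -/(t s).
  rewrite -(local_norm_sqr scf hess_gt0 _ (y - x) Ds).
  move: Nd Nh; rewrite -/r.
  move: (local_norm_ge0 (f := f) (x + s *: (y - x)) (y - x))
    (local_norm_ge0 (f := f) (x + s *: (y - x)) w).
  move: (local_norm f (x + s *: (y - x)) (y - x)) (local_norm f (x + s *: (y - x)) w).
  move=> a b a0 b0 Ha Hb /ler_normlP[_].
  have c0 : 0 < c s by rewrite invr_gt0 sr1.
  have {}Ha : a <= r * c s by rewrite /c ler_pdivlMr ?sr1// mulrC.
  have {}Hb : b <= Nw * c s by rewrite /c ler_pdivlMr ?sr1// mulrC.
  rewrite /G'; move: (c s) (t s) c0 Ha Hb => d e d0 Ha Hb He.
  have H1 : a ^+ 2 <= (r * d) ^+ 2 by rewrite ler_pXn2r// nnegrE mulr_ge0// ltW.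
  have H2 : b * a ^+ 2 <= Nw * d * (r * d) ^+ 2 by rewrite ler_pM// sqr_ge0.
  by nra.
have c_0 : c 0 = 1 by rewrite /c mul0r subr0 invr1.
have GE (s : R) : 0 <= s <= 1 -> q s - q 0 <= Nw * r * (c s * c s) - Nw * r.
  move=> /andP[s0 s1].
  have := @derive_nondecreasing R G G' 0 s s0.
  rewrite /G c_0 !mulr1 => H.
  apply: ler_sub_swap.
  apply: H => s' /andP[? s's]; [apply: dG|apply: G'0]; apply/andP; split => //;
    exact: le_trans s1.
(* Second integration, which yields Nw (1 / (1 - r) - 1 - r) = Nw r^2 / (1 - r). *)
pose J (s : R) : R := Nw * c s - Nw * r * s - p s + q 0 * s.
pose J' (s : R) : R := Nw * (r * c s ^+ 2) - Nw * r - q s + q 0.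
have dJ (s : R) : 0 <= s <= 1 -> is_derive s (1 : R) J (J' s).
  move=> s01.
  have dJ := is_deriveD (is_deriveB (is_deriveB (is_deriveZ Nw (dc _ s01))
    (is_deriveZ (Nw * r) (is_derive_id s (1 : R)))) (dp _ s01))
    (is_deriveZ (q 0) (is_derive_id s (1 : R))).
  apply: (is_derive_eq dJ); rewrite /J'.
  rewrite -[LHS]/(Nw * (r * c s ^+ 2) - Nw * r * 1 - q s + q 0 * 1).
  by rewrite !mulr1.
have J'0 (s : R) : 0 <= s <= 1 -> 0 <= J' s.
  by move=> s01; have := GE _ s01; rewrite /J'; move: (q s) (q 0) (c s) => a b d; nra.
have := @derive_nondecreasing R J J' 0 1 ler01 dJ J'0.
rewrite /J c_0 /c mul1r !mulr1 !mulr0 subr0 addr0.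
have -> : p 1 = 'D_w f y by rewrite /p seg1.
have -> : p 0 = 'D_w f x by rewrite /p scale0r addr0.
have -> : q 0 = 'D_(y - x) ('D_w f) x by rewrite /q scale0r addr0.
move: ('D_w f x) ('D_w f y) ('D_(y - x) ('D_w f) x) => a b d H.
have r10 : 0 < 1 - r by rewrite subr_gt0.
have -> : r ^+ 2 / (1 - r) * Nw = Nw / (1 - r) - Nw - Nw * r.
  by field; rewrite gt_eqF.
by lra.
Qed.

End Estimates.

(** * Dikin's ellipsoid and the barrier parameter *)

Section Barrier.
Context {R : realType} {n : nat}.
Local Notation V := 'cV[R]_n.
Context {D : set V} {f : V -> R}.
Hypothesis scf : self_concordant D f.
Hypothesis hess_gt0 : forall y, D y -> posdef (hess f y).
Implicit Types x y u v w : V.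

Let seg x y (s : R) : D x -> D y -> 0 <= s <= 1 -> D (x + s *: (y - x)).
Proof. exact: (sc_segment scf). Qed.

Lemma sc_line_interval x u (T s : R) : D x -> D (x + T *: u) -> 0 <= s <= T ->
  D (x + s *: u).
Proof.
move=> Dx DT /andP[s0 sT]; have [T0|T_neq0] := eqVneq T 0.
  by have -> : s = T by apply/le_anti; rewrite sT T0 s0.
have T0 : 0 < T by rewrite lt_neqAle eq_sym T_neq0 (le_trans s0).
have sT01 : 0 <= s / T <= 1 by rewrite divr_ge0 ?(ltW T0)//= ler_pdivrMr// mul1r.
have := seg x (x + T *: u) (s / T) Dx DT sT01.
by rewrite (addrC x (T *: u)) addrK scalerA divfK.
Qed.

(** The second derivative along the line is at most (r / (1 - s r))^2; one integration bounds the
    slope, a second one bounds [f]. The result is uniform in [T], which is what excludes a blow-up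
    in [dikin]. *)
Lemma sc_line_bounded x u (T : R) : D x -> local_norm f x u < 1 -> 0 <= T <= 1 ->
  D (x + T *: u) -> f (x + T *: u) <= f x + `|'D_u f x| + local_norm f x u / (1 - local_norm f x u).
Proof.
move=> Dx + /andP[T0 T1] DT; set r := local_norm f x u => r1.
have r0 : 0 <= r := local_norm_ge0 (f := f) x u.
have Dl (s : R) : 0 <= s <= T -> D (x + s *: u) by exact: sc_line_interval.
have sr1 (s : R) : 0 <= s <= T -> 0 < 1 - s * r.
  by move=> /andP[s0 sT]; have := ler_wpM2r r0 (le_trans sT T1); lra.
pose p (s : R) : R := 'D_u f (x + s *: u).
pose q (s : R) : R := 'D_u ('D_u f) (x + s *: u).
pose c (s : R) : R := (1 - s * r)^-1.
have dp (s : R) : 0 <= s <= T -> is_derive s (1 : R) p (q s).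
  by move=> sT; apply: (is_derive_line2 scf); exact: Dl.
have dc (s : R) : 0 <= s <= T -> is_derive s (1 : R) c (r * c s ^+ 2).
  move=> sT; rewrite /c exprVn; apply: is_derive_affineV.
  by rewrite gt_eqF// sr1.
pose G (s : R) : R := r * c s - p s.
pose G' (s : R) : R := r * (r * c s ^+ 2) - q s.
have dG (s : R) : 0 <= s <= T -> is_derive s (1 : R) G (G' s).
  by move=> sT; exact: is_deriveB (is_deriveZ r (dc _ sT)) (dp _ sT).
have G'0 (s : R) : 0 <= s <= T -> 0 <= G' s.
  move=> sT; have [s0 sT'] := andP sT.
  have : local_norm f (x + s *: u) u ^+ 2 = q s.
    by apply: (local_norm_sqr scf hess_gt0); exact: Dl.
  have Dls (s' : R) : 0 <= s' <= s -> D (x + s' *: u).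
    by move=> /andP[s'0 s's]; apply: Dl; rewrite s'0 (le_trans s's).
  have := local_norm_line_le scf hess_gt0 x u s s0 Dls.
  move: (local_norm_ge0 (f := f) (x + s *: u) u); rewrite -/r.
  move: (local_norm f (x + s *: u) u) => a a0 Ha.
  have {}Ha : a <= r * c s by rewrite /c ler_pdivlMr ?sr1// mulrC.
  rewrite /G' subr_ge0 => <-; rewrite mulrA -expr2 -exprMn.
  by rewrite ler_pXn2r// nnegrE// mulr_ge0// invr_ge0 ltW// sr1.
have c0 : c 0 = 1 by rewrite /c mul0r subr0 invr1.
have p_le (s : R) : 0 <= s <= T -> p s <= p 0 + r / (1 - r).
  move=> sT; have [s0 sT'] := andP sT.
  have : G 0 <= G s.
    apply: (@derive_nondecreasing R G G' 0 s s0) => s' /andP[s'0 s's];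
    [apply: dG|apply: G'0]; rewrite s'0; exact: le_trans sT'.
  rewrite /G c0 mulr1 => H.
  have cs : r * c s <= r / (1 - r).
    rewrite ler_wpM2l// lef_pV2 ?posrE ?subr_gt0//; last by rewrite -subr_gt0 sr1.
    by rewrite lerB// ler_piMl// (le_trans sT').
  have {cs}H := le_trans H (lerB cs (lexx (p s))).
  rewrite -lerBlDl; apply: le_trans (_ : r / (1 - r) - r <= _); last by rewrite gerBl.
  exact: ler_sub_swap.
pose B := `|p 0| + r / (1 - r).
pose J (s : R) : R := B * s - f (x + s *: u).
have rr0 : 0 <= r / (1 - r) by rewrite divr_ge0// subr_ge0 ltW.
have B0 : 0 <= B by rewrite addr_ge0.
have : J 0 <= J T.
  apply: (@derive_nondecreasing R J (fun s => B * 1 - p s) 0 T T0) => s sT.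
    exact: is_deriveB (is_deriveZ B (is_derive_id s (1 : R)))
      (is_derive_line1 scf x u s (Dl s sT)).
  rewrite mulr1 subr_ge0 (le_trans (p_le _ sT))// lerD2r; exact: ler_norm.
rewrite /J mulr0 sub0r scale0r addr0 => H.
have BT : B * T <= B by rewrite ler_piMr.
rewrite -addrA; have -> : `|'D_u f x| = `|p 0| by rewrite /p scale0r addr0.
have := le_trans H (lerB BT (lexx _)).
by rewrite lerBrDr (addrC (- f x)) lerBlDl.
Qed.

(* Dikin: by closedness [f] blows up where a segment leaves [D], but the Hessian
   stays bounded along a segment of local length smaller than 1. *)
Lemma dikin x u : D x -> local_norm f x u < 1 -> D (x + u).
Proof.
move=> Dx r1; pose S := [set s : R | 0 <= s <= 1 /\ D (x + s *: u)].
have S0 : S 0 by split; [rewrite lexx ler01|rewrite scale0r addr0].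
have ubS : ubound S 1 by move=> s [/andP[]].
have supS : has_sup S by split; [exists 0|exists 1].
have s0 : 0 <= sup S by exact: sup_upper_bound.
have s1 : sup S <= 1 by apply: ge_sup => //; exists 0.
have below (s : R) : 0 <= s < sup S -> S s.
  move=> /andP[s0' ss].
  have ss' : 0 < sup S - s by rewrite subr_gt0.
  have [t [/andP[t0 t1] Dt]] := sup_adherent ss' supS.
  rewrite subKr => st'; split; first by rewrite s0' (le_trans (ltW st')).
  by apply: sc_line_interval Dt _ => //; rewrite s0' ltW.
set t := sup S in s0 s1 below.
pose B := f x + `|'D_u f x| + local_norm f x u / (1 - local_norm f x u).
(* The supremum is attained: were the endpoint outside [D], the extended function would be +oo
   there, so by lower semicontinuity it would exceed [B] just before it. *)
have Dt : D (x + t *: u).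
  apply: contrapT => nDt.
  have t0 : 0 < t.
    rewrite lt_neqAle s0 andbT eq_sym; apply/eqP => tE.
    by apply: nDt; rewrite tE scale0r addr0.
  have /lower_semicontinuousP/(_ B) oB := sc_closed scf.
  have : nbhs (x + t *: u) [set y | (B%:E < extend D f y)%E].
    by apply: open_nbhs_nbhs; split => //=; rewrite /extend /patch memNset// ltry.
  have cl : (x + s *: u) @[s --> t] --> x + t *: u.
    by apply: cvgD; [exact: cvg_cst|exact: scalel_continuous].
  move=> /cl/nbhs_ballP[e /= e0 te].
  pose s := Num.max 0 (t - e / 2).
  have st : s < t by rewrite gt_max t0 gtrBl divr_gt0.
  have : ball t e s.
    rewrite -ball_normE /ball_/= gtr0_norm ?subr_gt0// ltrBlDl -ltrBlDr lt_max.
    by rewrite [t - e < t - _]ltrD2l ltrN2 ltr_pdivrMr// ltr_pMr// ltr1n orbT.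
  move=> /te /=; have [|s01 Ds] := below s; first by rewrite st andbT le_max lexx.
  by rewrite /extend /patch mem_set//= lte_fin ltNge sc_line_bounded.
(* If the supremum were below 1, openness of [D] would allow a step beyond it. *)
have [t1|t1] := eqVneq t 1; first by rewrite -[u]scale1r -t1.
have /nbhs_ballP[e /= e0 te] := line_nbhs scf x u t Dt.
pose s := Num.min 1 (t + e / 2).
have ts : t < s by rewrite lt_min lt_neqAle t1 s1 ltrDl divr_gt0.
have : S s.
  split; first by rewrite (le_trans s0 (ltW ts)) ge_min lexx.
  apply: te; rewrite -ball_normE /ball_/= distrC gtr0_norm ?subr_gt0// ltrBlDl gt_min.
  by rewrite [t + _ < t + e]ltrD2l ltr_pdivrMr// ltr_pMr// ltr1n orbT.
by move=> /(sup_upper_bound supS); rewrite leNgt ts.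
Qed.

(* For mu = nu this is the barrier inequality; mu is left free so that it can be
   improved by iterating [grad_bound_sqr]. *)
Definition grad_bound (mu : R) :=
  forall x u, D x -> ('D_u f x) ^+ 2 <= mu * 'D_u ('D_u f) x.

(** Where the slope p is positive, p' >= p^2 / mu, so 1/p decreases at rate at least 1 / mu. As 1/p
    is still positive at the far end, 1/p(0) > 1 / mu. *)
Lemma grad_segment_le (mu : R) x y : 0 < mu -> grad_bound mu -> D x -> D y ->
  'D_(y - x) f x <= mu.
Proof.
move=> mu0 Hmu Dx Dy.
pose p (s : R) : R := 'D_(y - x) f (x + s *: (y - x)).
pose q (s : R) : R := 'D_(y - x) ('D_(y - x) f) (x + s *: (y - x)).
have z01 : 0 <= (0 : R) <= 1 by rewrite lexx ler01.
have o01 : 0 <= (1 : R) <= 1 by rewrite lexx ler01.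
have -> : 'D_(y - x) f x = p 0 by rewrite /p scale0r addr0.
have [/le_trans|p0] := lerP (p 0) 0; first by apply; exact: ltW.
have dp (s : R) : 0 <= s <= 1 -> is_derive s (1 : R) p (q s).
  by move=> s01; apply: (is_derive_line2 scf); exact: seg.
have q0 (s : R) : 0 <= s <= 1 -> 0 <= q s.
  by move=> s01; apply: (sc_derive2_ge0 scf hess_gt0); exact: seg.
have p_gt0 (s : R) : 0 <= s <= 1 -> 0 < p s.
  move=> /andP[s0 s1]; apply: lt_le_trans p0 _.
  apply: (@derive_nondecreasing R p q 0 s s0) => s' /andP[s'0 s's];
  [apply: dp|apply: q0]; rewrite s'0; exact: le_trans s1.
pose G (s : R) : R := - (p s)^-1 - mu^-1 * s.
pose G' (s : R) : R := - (- p s ^- 2 * q s) - mu^-1 * 1.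
have dG (s : R) : 0 <= s <= 1 -> is_derive s (1 : R) G (G' s).
  move=> s01; have ps : p s != 0 by rewrite gt_eqF// p_gt0.
  exact: is_deriveB (is_deriveN (@is_deriveV _ _ s _ 1 ps (dp _ s01)))
    (is_deriveZ mu^-1 (is_derive_id s (1 : R))).
have G'0 (s : R) : 0 <= s <= 1 -> 0 <= G' s.
  move=> s01; have : p s ^+ 2 <= mu * q s by apply: Hmu; exact: seg.
  rewrite /G'; move: (p_gt0 _ s01); move: (p s) (q s) => a b a0 H.
  rewrite mulNr opprK mulr1 subr_ge0 mulrC ler_pdivlMr ?exprn_gt0//.
  by rewrite ler_pdivrMl.
have := @derive_nondecreasing R G G' 0 1 ler01 dG G'0.
rewrite /G mulr0 subr0 mulr1.
have := p_gt0 _ o01; move: (p 0) (p 1) p0 => a b a0 b0 H.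
rewrite -lef_pV2 ?posrE//; have := invr_gt0 b; rewrite b0 => b'0; lra.
Qed.

(** For c < 1, Dikin's ellipsoid contains the step of local length c in direction [v]. The segment
    bound for that step gives c times the slope at most mu times the local norm of [v]; then c tends
    to 1. *)
Lemma grad_bound_sqr (mu : R) : 0 < mu -> grad_bound mu -> grad_bound (mu ^+ 2).
Proof.
move=> mu0 Hmu x u Dx.
have [->|u0] := eqVneq u 0; first by rewrite !derive0 expr0n mulr0.
have half v : v != 0 -> 'D_v f x <= mu * local_norm f x v.
  move=> v0; have N0 := local_norm_gt0 scf hess_gt0 x v Dx v0.
  apply: ler_contract; first by apply: mulr_ge0; exact: ltW.
  move=> c /andP[c0 c1].
  have cN0 : 0 <= c / local_norm f x v by apply: divr_ge0; exact: ltW.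
  have Dy : D (x + (c / local_norm f x v) *: v).
    apply: dikin => //; rewrite (local_normZ scf x _ v Dx cN0).
    by rewrite divfK// gt_eqF.
  have := grad_segment_le mu x _ mu0 Hmu Dx Dy.
  rewrite (addrC x) addrK derive_dirZ; last exact: (sc_diff1 scf).
  by rewrite mulrAC ler_pdivrMr.
rewrite -(local_norm_sqr scf hess_gt0 x u Dx) -exprMn -[X in X <= _]real_normK ?num_real//.
rewrite ler_pXn2r ?nnegrE ?mulr_ge0 ?local_norm_ge0 ?(ltW mu0)//.
rewrite ler_norml half// andbT lerNl -(local_normN scf x u Dx).
apply: le_trans (half (- u) _); last by rewrite oppr_eq0.
by rewrite -[- u]scaleN1r derive_dirZ ?mulN1r//; exact: (sc_diff1 scf).
Qed.

Lemma grad_bound_ge1 (mu : R) : (0 < n)%N -> D !=set0 -> 0 < mu -> grad_bound mu -> 1 <= mu.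
Proof.
move=> n0 [x0 Dx0] mu0 Hmu; rewrite leNgt; apply/negP => mu1.
have Hk k : grad_bound (mu ^+ (2 ^ k)).
  elim: k => [|k IHk]; first by rewrite expr1.
  by rewrite expnSr exprM; apply: grad_bound_sqr => //; exact: exprn_gt0.
have g0 x u : D x -> 'D_u f x = 0.
  move=> Dx; apply/eqP; rewrite -sqrf_eq0 eq_le sqr_ge0 andbT.
  have h0 : 0 <= 'D_u ('D_u f) x by exact: (sc_derive2_ge0 scf hess_gt0).
  have : (mu ^+ k * 'D_u ('D_u f) x) @[k --> \oo] --> 0 * 'D_u ('D_u f) x.
    apply: cvgM; last exact: cvg_cst.
    by apply: cvg_expr; rewrite ger0_norm// ltW.
  rewrite mul0r => cvg0; apply: (cvgr_to_ge cvg0).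
  apply: nearW => k; apply: le_trans (Hk k x u Dx) _.
  (* Since k <= 2^k and mu < 1, the iterated constant is below mu^k, which tends to 0. *)
  rewrite ler_wpM2r// ler_wiXn2l ?(ltW mu0) ?(ltW mu1)//.
  exact: ltnW (ltn_expl _ _).
pose u : V := const_mx 1.
have u0 : u != 0.
  apply/eqP => /matrixP/(_ (Ordinal n0) 0)/eqP; by rewrite !mxE oner_eq0.
(* A gradient vanishing on the open set [D] would make the Hessian vanish at [x0]. *)
have := sc_derive2_gt0 scf hess_gt0 x0 u Dx0 u0.
rewrite (near_eq_derive (g := cst 0)) ?derive_cst ?ltxx//.
by apply: filterS (sc_nbhs scf _ Dx0) => y; exact: g0.
Qed.

Lemma barrier_grad_bound nu Omega : sc_barrier nu Omega D f -> grad_bound nu.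
Proof.
move=> bf x u Dx; have [->|u0] := eqVneq u 0; first by rewrite !derive0 expr0n mulr0.
have q0 := sc_derive2_gt0 scf hess_gt0 x u Dx u0.
have H (s : R) : 2 * (s * 'D_u f x) - s ^+ 2 * 'D_u ('D_u f) x <= nu.
  have := scb_bound bf Dx; rewrite -lee_fin; apply: le_trans.
  apply: ereal_sup_ubound; exists (s *: u) => //=; congr (_%:E).
  rewrite (dot_grad scf _ _ Dx) (local_norm_sqr scf hess_gt0 _ _ Dx) (sc_derive2Z scf _ _ _ Dx).
  by rewrite derive_dirZ//; exact: (sc_diff1 scf).
(* The maximizer of s |-> 2 s a - s^2 b is a / b, with value a^2 / b. *)
have := H ('D_u f x / 'D_u ('D_u f) x).
move: ('D_u f x) ('D_u ('D_u f) x) q0 => a b b0.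
have -> : 2 * (a / b * a) - (a / b) ^+ 2 * b = a ^+ 2 / b by field; rewrite gt_eqF.
by rewrite ler_pdivrMr.
Qed.


End Barrier.

(** * Optimality conditions *)

Section Optimality.
Context {R : realType} {n : nat}.
Local Notation V := 'cV[R]_n.
Context {D : set V} {f : V -> R} {g : V -> \bar R}.
Hypothesis scf : self_concordant D f.
Hypothesis hess_gt0 : forall y, D y -> posdef (hess f y).
Hypothesis g_proper : eproper g.
Hypothesis g_convex : econvex g.
Implicit Types x y u v w z : V.

Lemma closure_segment x y (a : R) : D x -> closure D y -> 0 <= a < 1 ->
  D (x + a *: (y - x)).
Proof.
move=> Dx cDy /andP[a0 a1].
have b0 : 1 - a != 0 by rewrite gt_eqF// subr_gt0.
(* [k w] is the point with x + a (y - x) = a w + (1 - a) k w. For [w] in [D] close to [y] it is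
   close to [x], hence in [D]. *)
pose k w := x + (a / (1 - a)) *: (y - w).
have ck : {for y, continuous k}.
  by apply: continuousD; [exact: cst_continuous|
    apply: continuousZl_tmp; apply: continuousB; [exact: cst_continuous|exact: cvg_id]].
have ky : k y = x by rewrite /k subrr scaler0 addr0.
have : nbhs (k y) D by rewrite ky; exact: (sc_nbhs scf).
move=> /ck /cDy[w [Dw /= Dkw]].
have := sc_segment scf _ w a Dkw Dw; rewrite a0 ltW// => /(_ isT).
congr D; transitivity (a *: w + (1 - a) *: k w).
  by rewrite scalerBl scale1r scalerBr addrCA.
rewrite /k scalerDr scalerA mulrCA mulfV// mulr1 addrCA -scalerDr (addrC w) subrK.
by rewrite scalerBl scale1r scalerBr -addrA (addrC (- _)).
Qed.

(** The points satisfying the inequality form a closed half-space containing [D]. The closure is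
    needed because the constrained optimum may lie on the boundary. *)
Lemma grad_closure_le (mu : R) x y : 0 < mu -> @grad_bound _ _ D f mu -> D x -> closure D y ->
  'D_(y - x) f x <= mu.
Proof.
move=> mu0 Hmu Dx cDy.
have dfx := sc_diff1 scf x Dx.
pose C := [set y | 'd f x (y - x) <= mu].
have cC : closed C.
  apply: (@closed_comp _ _ (fun y => 'd f x (y - x)) [set s | s <= mu]); last exact: closed_le.
  move=> z _; apply: (@continuous_comp _ _ _ (fun y => y - x) ('d f x)).
    by apply: continuousB; [exact: cvg_id|exact: cst_continuous].
  exact: diff_continuous.
rewrite deriveE//; apply: cC; apply: closure_subset cDy => z Dz.
by rewrite /C/= -deriveE//; exact: (grad_segment_le scf hess_gt0).
Qed.

Let G x := fine (g x).

Lemma proper_fineE x : edom g x -> g x = (G x)%:E.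
Proof.
move=> gx; rewrite /G fineK// fin_numE -ltey gx andbT -ltNye.
by have [+ _] := g_proper; apply.
Qed.

Lemma econvex_fineE x y (a : R) : edom g x -> edom g y -> 0 <= a <= 1 ->
  exists2 r : R, g (x + a *: (y - x)) = r%:E & r <= a * G y + (1 - a) * G x.
Proof.
move=> gx gy a01; have := g_convex y x a a01.
rewrite (proper_fineE x gx) (proper_fineE y gy) -!EFinM -EFinD.
have -> : a *: y + (1 - a) *: x = x + a *: (y - x).
  by rewrite scalerBl scale1r scalerBr addrCA.
move=> H; have E : edom g (x + a *: (y - x)) by rewrite /edom/= (le_lt_trans H)// ltry.
by exists (G (x + a *: (y - x))); [exact: proper_fineE|rewrite -lee_fin -proper_fineE].
Qed.

(** Difference quotients of the objective towards [y] are nonnegative. Convexity bounds those of [g]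
    by [G y - G z], so only [h] is differentiated. Only the open segment has to lie in [A], which
    admits boundary points [y]. *)
Lemma argmin_first_order (A : set V) (h : V -> R) (t l : R) z y : 0 < t ->
  is_argmin A (fun x => (h x)%:E + (t^-1)%:E * g x)%E z ->
  edom g z -> edom g y ->
  (forall a : R, 0 < a < 1 -> edom g (z + a *: (y - z)) -> A (z + a *: (y - z))) ->
  is_derive (0 : R) (1 : R) (fun a : R => h (z + a *: (y - z))) l ->
  0 <= l + t^-1 * (G y - G z).
Proof.
move=> t0 [_ minz] gz gy segA [dh dhE].
pose k := t^-1 * (G y - G z).
have : (fun a : R => a^-1 *: (h (z + (a *: (1 : R) + 0) *: (y - z)) - h (z + 0 *: (y - z))) + k)
    @ 0^'+ --> l + k.
  by apply: cvgD; [rewrite -dhE; apply: cvg_dnbhs_at_right; exact: dh|exact: cvg_cst].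
move=> /cvgr_to_ge; apply; near=> a.
have a0 : 0 < a by near: a; exact: nbhs_right_gt.
have a1 : a < 1 by near: a; exact: nbhs_right_lt.
have [|r gr rle] := econvex_fineE z y a gz gy; first by rewrite !ltW.
have := minz (z + a *: (y - z)).
rewrite gr (proper_fineE z gz) -!EFinM -!EFinD lee_fin => H.
have {}H := H (segA a _ _).
rewrite [a *: 1]mulr1 addr0 scale0r addr0.
have {}H : h z + t^-1 * G z <= h (z + a *: (y - z)) + t^-1 * r.
  by apply: H; [rewrite a0 a1|rewrite /edom/= gr ltry].
have : t^-1 * r <= t^-1 * (a * G y + (1 - a) * G z) by rewrite ler_wpM2l// invr_ge0 ltW.
rewrite -[X in 0 <= X]/(a^-1 * (h (z + a *: (y - z)) - h z) + k).
move: H; rewrite /k; move: (h z) (h (z + _)) (G z) (G y) (t^-1) => b c d e i H1 H2.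
have -> : a^-1 * (c - b) + i * (e - d) = a^-1 * (c - b + a * (i * (e - d))).
  by field; rewrite gt_eqF.
by apply: mulr_ge0; [rewrite invr_ge0 ltW|nra].
Unshelve. all: by end_near. Qed.

Definition quad_model y x : R :=
  f y + 'D_(x - y) f y + 2^-1 * 'D_(x - y) ('D_(x - y) f) y.

Lemma FhatE (t : R) y x : D y -> Fhat f g t y x = ((quad_model y x)%:E + (t^-1)%:E * g x)%E.
Proof. by move=> Dy; rewrite /Fhat (dot_grad scf _ _ Dy) (dot_hess scf _ _ _ Dy). Qed.

Lemma quad_modelD y x v (a : R) : D y ->
  quad_model y (x + a *: v) = quad_model y x + a * ('D_v f y + 'D_v ('D_(x - y) f) y)
    + a ^+ 2 / 2 * 'D_v ('D_v f) y.
Proof.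
move=> Dy; rewrite /quad_model (addrAC x).
rewrite derive_dirD; last exact: (sc_diff1 scf).
rewrite derive_dirZ; last exact: (sc_diff1 scf).
have BC (u w : V) := sc_derive2C scf u w y Dy.
have BP := fun (a b : R) (u v w : V) => sc_derive2P scf a b u v w y Dy.
have := @inner_sqrP R V (fun u v => 'D_u ('D_v f) y) BC BP 1 a (x - y) v.
rewrite scale1r => ->; rewrite (BC (x - y) v).
move: ('D_(x - y) f y) ('D_v f y) (f y) ('D_v ('D_(x - y) f) y)
  ('D_(x - y) ('D_(x - y) f) y) ('D_v ('D_v f) y) => b c d e i j.
by field.
Qed.

Lemma quad_modelE y x : D y ->
  quad_model y x = f y + 'D_(x - y) f y + 2^-1 * local_norm f y (x - y) ^+ 2.
Proof. by move=> Dy; rewrite (local_norm_sqr scf hess_gt0 y (x - y) Dy). Qed.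

#[local] Opaque quad_model Fhat.

Lemma is_derive_quad (c l k : R) :
  is_derive (0 : R) (1 : R) (fun a : R => c + a * l + a ^+ 2 / 2 * k) l.
Proof.
have dl : is_derive (0 : R) (1 : R) (fun a : R => c + a * l) l.
  have := is_deriveD (is_derive_cst c (0 : R) (1 : R))
    (is_deriveZ l (is_derive_id (0 : R) (1 : R))).
  rewrite add0r [l *: 1]mulr1; congr is_derive; apply/funext => a /=.
  by rewrite -[LHS]/(c + l * a) mulrC.
have dk : is_derive (0 : R) (1 : R) (fun a : R => a ^+ 2 / 2 * k) 0.
  have := is_deriveZ (k / 2) (is_deriveX 2 (is_derive_id (0 : R) (1 : R))).
  rewrite expr1 mulr0 scale0r scaler0; congr is_derive; apply/funext => a /=.
  by rewrite -[LHS]/(k / 2 * a ^+ 2); field.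
by have := is_deriveD dl dk; rewrite addr0.
Qed.

Lemma minimizer_first_order (t : R) z y : 0 < t -> is_argmin (domF D g) (F f g t) z ->
  closure D y -> edom g y -> 0 <= 'D_(y - z) f z + t^-1 * (G y - G z).
Proof.
move=> t0 zmin cDy gy; have [[Dz gz] _] := zmin.
apply: (@argmin_first_order _ f t _ z y t0 zmin gz gy).
  move=> a /andP[a0 a1] ga; split => //.
  by apply: closure_segment => //; rewrite ltW.
have Dz0 : D (z + 0 *: (y - z)) by rewrite scale0r addr0.
have := is_derive_line1 scf z (y - z) 0 Dz0.
by rewrite scale0r addr0.
Qed.

Lemma subproblem_first_order (t : R) y xb w : 0 < t -> D y ->
  subproblem_solution D f g t y xb -> domF D g w ->
  0 <= 'D_(w - xb) f y + 'D_(w - xb) ('D_(xb - y) f) y + t^-1 * (G w - G xb).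
Proof.
move=> t0 Dy [[Dxb gxb] xbmin] [Dw gw].
apply: (@argmin_first_order (domF D g) (quad_model y) t _ xb w t0 _ gxb gw).
- split; first exact: (conj Dxb gxb).
  by move=> x domx; move: (xbmin x domx); rewrite (FhatE t y xb Dy) (FhatE t y x Dy).
- move=> a /andP[a0 a1] ga; split => //.
  by apply: (sc_segment scf) => //; rewrite !ltW.
- have -> : (fun a : R => quad_model y (xb + a *: (w - xb))) =
      (fun a : R => quad_model y xb + a * ('D_(w - xb) f y + 'D_(w - xb) ('D_(xb - y) f) y)
         + a ^+ 2 / 2 * 'D_(w - xb) ('D_(w - xb) f) y).
    by apply/funext => a; exact: quad_modelD.
  exact: is_derive_quad.
Qed.

Lemma delta_solution_le (t delta : R) y xb xp w : 0 < t -> D y ->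
  subproblem_solution D f g t y xb -> delta_solution D f g t y xb delta xp ->
  domF D g w ->
  quad_model y xp + t^-1 * G xp <= quad_model y w + t^-1 * G w + delta ^+ 2 / 2.
Proof.
move=> t0 Dy [[Dxb gxb] xbmin] [[Dxp gxp] +] [Dw gw].
have := xbmin w (conj Dw gw).
rewrite (FhatE t y xb Dy) (FhatE t y xp Dy) (FhatE t y w Dy).
rewrite (proper_fineE xb gxb) (proper_fineE xp gxp) (proper_fineE w gw).
move: (quad_model y xb) (quad_model y xp) (quad_model y w) (G xb) (G xp) (G w).
move=> a b c a' b' c'; rewrite -!EFinM -!EFinD !lee_fin; lra.
Qed.

(** By the first-order condition at [xb], the quadratic model with [g] added grows from [xb] to [xp]
    by at least half the squared local norm of [xp - xb], and by at most delta^2 / 2. *)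
Lemma delta_solution_norm (t delta : R) y xb xp : 0 < t -> 0 <= delta -> D y ->
  subproblem_solution D f g t y xb -> delta_solution D f g t y xb delta xp ->
  local_norm f y (xp - xb) <= delta.
Proof.
move=> t0 d0 Dy xbsol xpsol; have [[Dxb gxb] _] := xbsol; have [[Dxp gxp] _] := xpsol.
have := delta_solution_le _ _ _ _ _ xb t0 Dy xbsol xpsol (conj Dxb gxb).
have := subproblem_first_order _ _ _ xp t0 Dy xbsol (conj Dxp gxp).
have := quad_modelD y xb (xp - xb) 1 Dy.
have -> : xb + 1 *: (xp - xb) = xp by rewrite scale1r subrKC.
rewrite -(local_norm_sqr scf hess_gt0 y (xp - xb) Dy) => ->.
move: (local_norm_ge0 (f := f) y (xp - xb)).
move: (local_norm f y (xp - xb)) (quad_model y xb) ('D_(xp - xb) f y)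
  ('D_(xp - xb) ('D_(xb - y) f) y) (G xb) (G xp) (t^-1) => a b c d e i j a0 H1 H2.
have : a ^+ 2 <= delta ^+ 2 by lra.
by rewrite ler_pXn2r.
Qed.

End Optimality.

(** * Constants *)

Section Constants.
Context {R : realType}.
(** [k] stands for 2.581 and [C] for C(beta). *)
Variables beta k C : R.
Let s := Num.sqrt beta.
Hypothesis beta_gt0 : 0 < beta.
Hypothesis beta_le : beta <= 15 / 100.
Hypothesis kE : 1000 * k = 2581.
Hypothesis CE : C = (s - k * beta) / (k + s).

Let s2 : beta = s * s.
Proof. by rewrite -expr2 sqr_sqrtr// ltW. Qed.

Let s_gt0 : 0 < s.
Proof. by rewrite sqrtr_gt0. Qed.

Let s_le : s <= 39 / 100.
Proof.
have := s2; have := s_gt0; move: s beta_le => a b_le a0 E.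
rewrite leNgt; apply/negP => H.
have : 39 / 100 * (39 / 100) < a * a by apply: ltr_pM => //; lra.
by lra.
Qed.

Let k_gt0 : 0 < k.
Proof. by have := kE; lra. Qed.

Let ks_gt0 : 0 < k + s. Proof. exact: addr_gt0. Qed.

Lemma path_const_def : C * (k + s) = s - k * beta.
Proof. by rewrite CE divfK// gt_eqF. Qed.

Lemma path_const_gt0 : 0 < C.
Proof.
rewrite CE divr_gt0// s2 subr_gt0 mulrA gtr_pMl//.
(* The claim is k sqrt(beta) < 1. This is where beta <= 0.15 enters: 2.581^2 * 0.15 is about
   0.9992. *)
rewrite ltNge; apply/negP => H.
have : 1 * 1 <= (k * s) * (k * s) by apply: ler_pM.
have -> : k = 2581 / 1000 by have := kE; lra.
by rewrite mulrACA -s2 => H1; have := beta_le; lra.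
Qed.

Lemma path_const_lt1 : C < 1.
Proof. by rewrite CE ltr_pdivrMr// mul1r; have := mulr_gt0 k_gt0 beta_gt0; have := k_gt0; lra. Qed.

(** This equation explains the formula for C(beta): it is the solution of (beta + C) / (1 - C) =
    sqrt(beta) / 2.581. *)
Lemma path_const_radius : (1 - C) * s = k * (beta + C).
Proof. by have := path_const_def; have := s2; lra. Qed.

(* [dist] plays the role of the distance between consecutive minimizers. *)
Lemma path_radius (dist a b : R) : 0 <= dist -> dist <= C -> 0 <= b ->
  (1 - dist) * b <= beta -> a <= b + dist -> k * a <= s.
Proof.
move=> d0 dC b0 H ab; have E := path_const_radius; have C1 := path_const_lt1.
have d1 : 0 < 1 - dist by lra.
rewrite -(ler_pM2l d1) mulrCA.
have H1 : (1 - dist) * a <= beta + C.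
  have : (1 - dist) * a <= (1 - dist) * (b + dist) by rewrite ler_wpM2l// ltW.
  by have := mulr_ge0 d0 d0; lra.
have H2 : (1 - C) * s <= (1 - dist) * s by rewrite ler_wpM2r ?(ltW s_gt0)// lerB.
by apply: le_trans H2; rewrite E ler_wpM2l// ltW.
Qed.

Lemma newton_radius (lam r delta : R) : 0 <= lam -> k * lam <= s ->
  0 <= r -> (1 - lam) * r <= lam -> 0 <= delta <= 3 / 40 * beta ->
  [/\ lam < 1, r < 1 & delta + r ^+ 2 / (1 - r) <= (1 - lam) * beta].
Proof.
move=> lam0 lam_le r0 r_le /andP[d0 d1].
have k25 : 5 / 2 <= k by have := kE; lra.
have lam25 : 5 / 2 * lam <= s by apply: le_trans lam_le; rewrite ler_wpM2r.
have lam1 : lam <= 4 / 25 by have := s_le; lra.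
have lam2 : lam * lam <= 4 / 25 * beta.
  have : (5 / 2 * lam) * (5 / 2 * lam) <= s * s by apply: ler_pM => //; rewrite mulr_ge0.
  by rewrite -s2; lra.
have r1 : r <= 6 / 5 * lam.
  have : 21 / 25 * r <= (1 - lam) * r by rewrite ler_wpM2r//; lra.
  by lra.
have r2 : r * r <= 6 / 5 * lam * (6 / 5 * lam) by apply: ler_pM.
have r82 : 4 / 5 <= 1 - r by lra.
have lamb : (1 - lam) * beta >= 21 / 25 * beta by rewrite ler_wpM2r ?(ltW beta_gt0)//; lra.
split; [lra|lra|].
have : r ^+ 2 / (1 - r) <= 5 / 4 * (r * r).
  rewrite ler_pdivrMr; last lra.
  have : (r * r) * (4 / 5) <= r * r * (1 - r) by rewrite ler_wpM2l ?mulr_ge0.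
  by rewrite expr2; lra.
by move: (r ^+ 2 / (1 - r)) => q; lra.
Qed.

Let rho := 4 / 10 * s.

Let rho_gt0 : 0 < rho.
Proof. by rewrite mulr_gt0. Qed.

Let rho_lt1 : rho < 1.
Proof. by have := s_le; rewrite /rho; lra. Qed.

(** Termwise comparison with rho = 0.4 sqrt(beta): as 1 / 2.581 < 0.4, lam <= rho and r <= rho / (1
    - rho); moreover 0.075^2 / 2 < 0.003. *)
Lemma psi_ge (nu lam r delta E : R) : 0 <= lam -> k * lam <= s ->
  0 <= r -> (1 - lam) * r <= lam -> 0 <= delta <= 3 / 40 * beta -> E <= beta ->
  nu + Num.sqrt nu * E + r ^+ 2 / 2 + delta ^+ 2 / 2 <= psi beta nu.
Proof.
move=> lam0 lam_le r0 r_le /andP[d0 d1] E_le.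
rewrite /psi -/s -/rho.
have rho1 : 0 < 1 - rho by rewrite subr_gt0.
have k25 : 5 / 2 <= k by have := kE; lra.
have lam25 : 5 / 2 * lam <= s by apply: le_trans lam_le; rewrite ler_wpM2r.
have lam_rho : lam <= rho by rewrite /rho; lra.
apply: lerD; last first.
  have : delta * delta <= (3 / 40 * beta) * (3 / 40 * beta) by apply: ler_pM.
  by have := mulr_ge0 (ltW beta_gt0) (ltW beta_gt0); rewrite !expr2; lra.
apply: lerD; last first.
  have r_rho : r <= rho / (1 - rho).
    rewrite ler_pdivlMr//; apply: (le_trans _ lam_rho); apply: (le_trans _ r_le).
    by rewrite [leLHS]mulrC; apply: ler_wpM2r => //; rewrite lerD2l lerN2.
  have rr : r * r <= rho / (1 - rho) * (rho / (1 - rho)) by apply: ler_pM.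
  apply: (@le_trans _ _ (rho / (1 - rho) * (rho / (1 - rho)))).
    by have := mulr_ge0 r0 r0; rewrite expr2; lra.
  have -> : rho / (1 - rho) * (rho / (1 - rho)) = rho / (1 - rho) ^+ 2 * rho.
    by field; rewrite gt_eqF.
  rewrite ler_wpM2l//; first by rewrite divr_ge0 ?sqr_ge0 ?ltW.
  by have := beta_gt0; lra.
rewrite lerD2l ler_wpM2l ?sqrtr_ge0// (le_trans E_le)//.
rewrite ler_pdivlMr// ler_piMr ?(ltW beta_gt0)//.
by rewrite gerBl ltW.
Qed.

Lemma psi_gt0 (nu : R) : 0 < nu -> 0 < psi beta nu.
Proof.
move=> nu0; have /lt_le_trans-> // : 0 < nu + Num.sqrt nu * 0 + 0 ^+ 2 / 2 + 0 ^+ 2 / 2.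
  by rewrite mulr0 expr0n/= !mul0r !addr0.
apply: (psi_ge nu 0 0 0 0); rewrite ?mulr0 ?lexx//; last exact: ltW.
  by rewrite ltW.
by rewrite mulr_ge0// ltW.
Qed.

End Constants.

(** * The path-following step *)

#[local] Opaque quad_model.

Section Steps.
Context {R : realType} {n : nat}.
Local Notation V := 'cV[R]_n.
Context {D : set V} {f : V -> R} {g : V -> \bar R} {nu : R}.
Hypothesis scf : self_concordant D f.
Hypothesis hess_gt0 : forall y, D y -> posdef (hess f y).
Hypothesis nu_gt0 : 0 < nu.
Hypothesis f_bound : @grad_bound R n D f nu.
Hypothesis g_proper : eproper g.
Hypothesis g_convex : econvex g.
Implicit Types x y u v w z : V.

Let G x := fine (g x).

Let deriveN u (h : V -> R) x : differentiable h x -> 'D_(- u) h x = - 'D_u h x.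
Proof. by move=> dh; rewrite -scaleN1r derive_dirZ// mulN1r. Qed.

Lemma grad_local_norm x u : D x -> `|'D_u f x| <= Num.sqrt nu * local_norm f x u.
Proof.
move=> Dx; rewrite (local_normE scf _ _ Dx) -sqrtrM ?(ltW nu_gt0)//.
rewrite -sqrtr_sqr ler_sqrt ?f_bound//.
by apply: mulr_ge0; [exact: ltW|exact: (sc_derive2_ge0 scf hess_gt0)].
Qed.

(** The optimality conditions of the two minimizers, each multiplied by its own parameter, are added
    so that [g] cancels. What remains bounds the gradient difference by sig times a slope at [z'];
    strong monotonicity and the barrier inequality conclude. *)
Lemma minimizer_dist (t sig : R) z z' : 0 < t -> 0 < sig < 1 ->
  is_argmin (domF D g) (F f g t) z -> is_argmin (domF D g) (F f g ((1 - sig) * t)) z' ->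
  local_norm f z' (z - z') <= (1 + local_norm f z' (z - z')) * (sig * Num.sqrt nu).
Proof.
move=> t0 /andP[sig0 sig1] zmin z'min.
have [[Dz gz] _] := zmin; have [[Dz' gz'] _] := z'min.
have t'0 : 0 < (1 - sig) * t by rewrite mulr_gt0// subr_gt0.
have := minimizer_first_order scf g_proper g_convex t z z' t0 zmin (subset_closure Dz') gz'.
have := minimizer_first_order scf g_proper g_convex _ z' z t'0 z'min (subset_closure Dz) gz.
rewrite -(opprB z z') (deriveN (z - z') f z (sc_diff1 scf z Dz)).
have := grad_monotone scf hess_gt0 z' z Dz' Dz.
have /ler_normlP[+ _] := grad_local_norm z' (z - z') Dz'.
rewrite -/(G z) -/(G z').
move: (local_norm_ge0 (f := f) z' (z - z')) (sqrtr_ge0 nu).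
move: (local_norm f z' (z - z')) ('D_(z - z') f z) ('D_(z - z') f z') (G z) (G z') (Num.sqrt nu).
move=> N P Q a b c N0 c0 HQ HM H1 H2.
have {}H1 : 0 <= (1 - sig) * t * Q + (a - b).
  by have := mulr_ge0 (ltW t'0) H1; rewrite mulrDr mulVKf ?gt_eqF.
have {}H2 : 0 <= - (t * P) + (b - a).
  by have := mulr_ge0 (ltW t0) H2; rewrite mulrDr mulVKf ?gt_eqF// mulrN.
have PQ : P - Q <= sig * - Q by rewrite -(ler_pM2l t0); lra.
have {}HQ : sig * - Q <= sig * (c * N) by rewrite ler_wpM2l// ltW.
have [N_eq0|N_neq0] := eqVneq N 0.
  by rewrite N_eq0 addr0 mul1r mulr_ge0// ltW.
have N_gt0 : 0 < N by rewrite lt_neqAle eq_sym N_neq0.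
rewrite -(ler_pM2r N_gt0) -expr2 (le_trans HM)//.
have -> : (1 + N) * (sig * c) * N = (1 + N) * (sig * (c * N)) by ring.
by apply: ler_wpM2l; [rewrite addr_ge0|exact: le_trans PQ HQ].
Qed.

(** * One inexact Newton step from [y], compared with the new minimizer [z] *)

Section NewtonStep.
Variables (t delta : R) (y z xb xp : V).
Hypothesis t_gt0 : 0 < t.
Hypothesis delta_ge0 : 0 <= delta.
Hypothesis y_dom : D y.
Hypothesis z_min : is_argmin (domF D g) (F f g t) z.
Hypothesis xb_sol : subproblem_solution D f g t y xb.
Hypothesis xp_sol : delta_solution D f g t y xb delta xp.

Let r := local_norm f y (z - y).

Lemma newton_local_norm : (1 - local_norm f z (y - z)) * r <= local_norm f z (y - z).
Proof.
have [[Dz _] _] := z_min.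
by rewrite /r -(opprB y z) (local_normN scf _ _ y_dom) (local_norm_step scf hess_gt0).
Qed.

(** Adding the optimality conditions of [z] and [xb] cancels [g]. The squared local norm of [xb - z]
    is then at most the Taylor remainder of the gradient in direction [xb - z]. *)
Lemma newton_exact_dist : r < 1 -> local_norm f y (xb - z) <= r ^+ 2 / (1 - r).
Proof.
move=> r1; have [[Dz gz] _] := z_min; have [[Dxb gxb] _] := xb_sol.
have := grad_taylor scf hess_gt0 y z (xb - z) y_dom Dz r1.
have := minimizer_first_order scf g_proper g_convex t z xb t_gt0 z_min (subset_closure Dxb) gxb.
have := subproblem_first_order scf g_proper g_convex t y xb z t_gt0 y_dom xb_sol (conj Dz gz).
have -> : xb - y = (1 : R) *: (xb - z) + (1 : R) *: (z - y).
  by rewrite !scale1r addrA subrK.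
rewrite -(opprB xb z) (deriveN _ _ _ (sc_diff1 scf y y_dom)).
rewrite (deriveN _ _ _ (sc_diff2 scf _ y y_dom)).
rewrite (sc_derive2C scf _ _ y y_dom) (sc_derive2P scf _ _ _ _ _ y y_dom).
rewrite -(local_norm_sqr scf hess_gt0 y (xb - z) y_dom) -/r -/(G z) -/(G xb).
have : 0 <= r ^+ 2 / (1 - r) by rewrite divr_ge0 ?sqr_ge0// subr_ge0 ltW.
move: (local_norm_ge0 (f := f) y (xb - z)); move: (r ^+ 2 / (1 - r)) => q.
move: (local_norm f y (xb - z)) ('D_(xb - z) f z) ('D_(xb - z) f y)
  ('D_(z - y) ('D_(xb - z) f) y) (G z) (G xb) (t^-1) => N a b c d e i N0 q0 H1 H2 H3.
have [->//|N_neq0] := eqVneq N 0.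
have N_gt0 : 0 < N by rewrite lt_neqAle eq_sym N_neq0.
by rewrite -(ler_pM2r N_gt0) -expr2; lra.
Qed.

Lemma newton_dist : r < 1 -> local_norm f y (xp - z) <= delta + r ^+ 2 / (1 - r).
Proof.
move=> r1; have [[Dxp _] _] := xp_sol.
have -> : xp - z = (xp - xb) + (xb - z) by rewrite addrA subrK.
apply: le_trans (local_normD scf hess_gt0 _ _ _ y_dom) _.
apply: lerD; last exact: newton_exact_dist.
exact: (delta_solution_norm scf hess_gt0 g_proper g_convex t delta y xb xp).
Qed.

Lemma newton_dist_min : local_norm f z (y - z) < 1 ->
  (1 - local_norm f z (y - z)) * local_norm f z (xp - z) <= local_norm f y (xp - z).
Proof.
move=> lam1; have [[Dz _] _] := z_min.
exact: (hess_step scf hess_gt0).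
Qed.

(** The model at [xp] is compared with the model at [z]. The quadratic term at [xp] is nonnegative
    and dropped, the one at [z] is r^2 / 2, and the linear terms differ by the slope in direction
    [xp - z]. *)
Lemma newton_value (E : R) : local_norm f y (xp - z) <= E ->
  G xp - G z <= t * (Num.sqrt nu * E + r ^+ 2 / 2 + delta ^+ 2 / 2).
Proof.
move=> NE; have [[Dz gz] _] := z_min; have [[Dxp gxp] _] := xp_sol.
have := delta_solution_le scf g_proper t delta y xb xp z t_gt0 y_dom xb_sol xp_sol (conj Dz gz).
rewrite (quad_modelE scf hess_gt0 y xp y_dom) (quad_modelE scf hess_gt0 y z y_dom) -/r.
have -> : 'D_(xp - y) f y = 'D_(xp - z) f y + 'D_(z - y) f y.
  by rewrite -derive_dirD; [rewrite addrA subrK|exact: (sc_diff1 scf)].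
have /ler_normlP[+ _] := grad_local_norm y (xp - z) y_dom.
have : Num.sqrt nu * local_norm f y (xp - z) <= Num.sqrt nu * E.
  by rewrite ler_wpM2l// sqrtr_ge0.
have := sqr_ge0 (local_norm f y (xp - y)).
rewrite -/(G z) -/(G xp).
move: (local_norm f y (xp - y) ^+ 2) (local_norm f y (xp - z)) (f y) ('D_(xp - z) f y)
  ('D_(z - y) f y) (r ^+ 2) (delta ^+ 2) (Num.sqrt nu * E) => a b c d e i j l.
move: (Num.sqrt nu * b) (G xp) (G z) => m o p H1 H2 H3 H4.
rewrite -ler_pdivrMl// mulrBr; lra.
Qed.

End NewtonStep.

(** The optimality condition at [z] bounds the gap by t times the slope of [f] from [z] towards [y],
    which the barrier inequality bounds by nu. *)
Lemma minimizer_value (t : R) z y : 0 < t -> is_argmin (domF D g) (F f g t) z ->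
  closure D y -> edom g y -> G z - G y <= t * nu.
Proof.
move=> t0 zmin cDy gy; have [[Dz gz] _] := zmin.
have := minimizer_first_order scf g_proper g_convex t z y t0 zmin cDy gy.
have := grad_closure_le scf hess_gt0 nu z y nu_gt0 f_bound Dz cDy.
rewrite -/(G z) -/(G y); move: ('D_(y - z) f z) (G z) (G y) => a b c H1 H2.
rewrite -ler_pdivrMl//; lra.
Qed.

End Steps.

(** * The Phase II iteration and its complexity *)

Lemma gap_combine {R : realFieldType} (a b c d m p q e : R) :
  a - b <= d * (p + q + e) -> b - c <= d * m -> forall psi, m + p + q + e <= psi ->
  0 <= d -> a - c <= psi * d.
Proof. by move=> H1 H2 psi H3 d0; have := ler_wpM2r d0 H3; lra. Qed.

Section PhaseII.
Context {R : realType} {n : nat}.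
Local Notation V := 'cV[R]_n.
Context {D Omega : set V} {f : V -> R} {g : V -> \bar R} {nu beta : R} {xopt : V}.
Context {t delta : nat -> R} {x xs xbar : nat -> V}.
Hypothesis n_gt0 : (0 < n)%N.
Hypothesis beta_gt0 : 0 < beta.
Hypothesis beta_le : beta <= 15 / 100.
Hypothesis f_barrier : sc_barrier nu Omega D f.
Hypothesis hess_gt0 : forall y, D y -> posdef (hess f y).
Hypothesis g_proper : eproper g.
Hypothesis g_convex : econvex g.
Hypothesis xopt_min : is_argmin Omega g xopt.
Hypothesis run : phaseII D f g nu beta t delta x xs xbar.

Let C := Cbeta beta.
Let scf := scb_sc f_barrier.
Let nu_gt0 := scb_nu f_barrier.
Let f_bound := barrier_grad_bound scf hess_gt0 nu Omega f_barrier.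
Let G y := fine (g y).

Let kE : 1000 * (2581 / 1000) = 2581 :> R.
Proof. by lra. Qed.

Let C_gt0 : 0 < C := path_const_gt0 beta _ C beta_gt0 beta_le kE erefl.

Let CE : C = (Num.sqrt beta - 2581 / 1000 * beta) / (2581 / 1000 + Num.sqrt beta).
Proof. by []. Qed.

Lemma barrier_sqrt_ge1 : 1 <= Num.sqrt nu.
Proof.
have D0 : D !=set0 by exists (x 0%N); have [] := p2_x0 run.
have := grad_bound_ge1 scf hess_gt0 nu n_gt0 D0 nu_gt0 f_bound.
by rewrite -[X in X <= Num.sqrt _]sqrtr1 ler_sqrt// ltW.
Qed.

Let sqrt_nu_gt0 : 0 < Num.sqrt nu := lt_le_trans ltr01 barrier_sqrt_ge1.

Lemma sigma_sqrt : sigma beta nu * Num.sqrt nu = C / (1 + C).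
Proof.
have C1 : 0 < 1 + C by rewrite addr_gt0.
by rewrite /sigma -/C; field; rewrite (gt_eqF C1) (gt_eqF sqrt_nu_gt0).
Qed.

Lemma sigma_itv : 0 < sigma beta nu < 1.
Proof.
have C1 : 0 < 1 + C by rewrite addr_gt0.
have s0 : 0 < sigma beta nu := divr_gt0 C_gt0 (mulr_gt0 C1 sqrt_nu_gt0).
rewrite s0/=; apply: (@le_lt_trans _ _ (C / (1 + C))).
  by rewrite -sigma_sqrt (ler_pMr _ s0) barrier_sqrt_ge1.
by rewrite (ltr_pdivrMr _ _ C1) mul1r ltrDr.
Qed.

#[local] Opaque Cbeta sigma psi.

Lemma phaseII_t k : t k = (1 - sigma beta nu) ^+ k * t 0%N.
Proof.
elim: k => [|k IHk]; first by rewrite mul1r.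
by rewrite (p2_t run) IHk exprS mulrA.
Qed.

Lemma phaseII_t_gt0 k : 0 < t k.
Proof.
have /andP[s0 s1] := sigma_itv.
by rewrite phaseII_t mulr_gt0 ?(p2_t0 run)// exprn_gt0// subr_gt0.
Qed.

Lemma phaseII_dom k : domF D g (x k).
Proof. by case: k => [|k]; [exact: p2_x0 run|have [] := p2_step run k]. Qed.

(** The choice of sigma gives d <= (1 + d) C / (1 + C) for the distance d of consecutive minimizers,
    which is d <= C. *)
Lemma minimizer_drift k : local_norm f (xs k.+1) (xs k - xs k.+1) <= C.
Proof.
have C1 : 0 < 1 + C by rewrite addr_gt0.
have := p2_min run k.+1; rewrite (p2_t run) => min'.
have := minimizer_dist scf hess_gt0 nu_gt0 f_bound g_proper g_convex (t k) _ (xs k) (xs k.+1)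
  (phaseII_t_gt0 k) sigma_itv (p2_min run k) min'.
rewrite sigma_sqrt; move: (local_norm _ _ _) => d.
rewrite mulrA ler_pdivlMr// mulrDl mulrDr mul1r mulr1; lra.
Qed.

(** A change of minimizer changes both the metric, by a factor controlled by the Hessian comparison,
    and the center, by the triangle inequality. *)
Lemma drifted_radius k : local_norm f (xs k) (x k - xs k) <= beta ->
  2581 / 1000 * local_norm f (xs k.+1) (x k - xs k.+1) <= Num.sqrt beta.
Proof.
move=> dk; have [[Dz gz] _] := p2_min run k; have [[Dz' gz'] _] := p2_min run k.+1.
have C1 := path_const_lt1 beta _ C beta_gt0 kE CE.
apply: (path_radius beta _ C beta_gt0 kE CE (local_norm f (xs k.+1) (xs k - xs k.+1))
  _ (local_norm f (xs k.+1) (x k - xs k))).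
- exact: local_norm_ge0.
- exact: minimizer_drift.
- exact: local_norm_ge0.
- apply: le_trans dk; apply: (hess_step scf hess_gt0 (xs k.+1) (xs k) _ Dz' Dz).
  exact: le_lt_trans (minimizer_drift k) C1.
- have -> : x k - xs k.+1 = (x k - xs k) + (xs k - xs k.+1) by rewrite addrA subrK.
  exact: (local_normD scf hess_gt0).
Qed.

Lemma phaseII_step k : local_norm f (xs k) (x k - xs k) <= beta ->
  local_norm f (xs k.+1) (x k.+1 - xs k.+1) <= beta /\
  G (x k.+1) - G xopt <= psi beta nu * t k.+1.
Proof.
move=> dk; have rad := drifted_radius k dk.
have [Dx gx] := phaseII_dom k; have t0 := phaseII_t_gt0 k.+1.
have := p2_delta run k.
have -> : 75 / 1000 * beta = 3 / 40 * beta by lra.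
move=> del; have [del0 _] := andP del.
have min := p2_min run k.+1; have sol := p2_xbar run k; have stp := p2_step run k.
have r_le := newton_local_norm scf hess_gt0 _ _ _ Dx min.
have lam0 := local_norm_ge0 (f := f) (xs k.+1) (x k - xs k.+1).
have r0 := local_norm_ge0 (f := f) (x k) (xs k.+1 - x k).
have [lam1 r1 E_le] := newton_radius _ _ beta_gt0 beta_le kE _ _ _ lam0 rad r0 r_le del.
have dist := newton_dist scf hess_gt0 g_proper g_convex _ _ _ _ _ _ t0 del0 Dx min sol stp r1.
have distb := le_trans dist E_le.
have dist_min := newton_dist_min scf hess_gt0 _ _ _ (x k.+1) Dx min lam1.
split.
  by have := le_trans dist_min distb; rewrite ler_pM2l// subr_gt0.
(* The gap estimate uses the distance measured at the old iterate, which is at most (1 - lam) beta,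
   hence at most beta. *)
have Nle : local_norm f (x k) (x k.+1 - xs k.+1) <= beta.
  apply: le_trans distb _; rewrite ler_piMl ?(ltW beta_gt0)//.
  by rewrite gerBl.
have val := newton_value scf hess_gt0 nu_gt0 f_bound g_proper
  _ _ _ _ _ _ t0 Dx min sol stp _ (lexx _).
have gopt : edom g xopt.
  have [_ /(_ (x k))] := xopt_min; rewrite -(scb_Dom f_barrier) => H.
  by apply: le_lt_trans (H _) gx; exact: subset_closure.
have cl : closure D xopt by rewrite (scb_Dom f_barrier); have [] := xopt_min.
have valz := minimizer_value scf hess_gt0 nu_gt0 f_bound g_proper g_convex _ _ _ t0 min cl gopt.
have psi_le := psi_ge _ _ beta_gt0 beta_le kE nu _ _ _ _ lam0 rad r0 r_le del Nle.
exact: (gap_combine _ _ _ _ _ _ _ _ val valz _ psi_le (ltW t0)).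
Qed.

Lemma phaseII_dist k : local_norm f (xs k) (x k - xs k) <= beta.
Proof. by elim: k => [|k /phaseII_step[]//]; exact: p2_init run. Qed.

(** The bound is produced by a Newton step, hence starts at index 1. Iterates lie in [D], a subset
    of [Omega], so the gap is nonnegative and one side suffices. *)
Lemma phaseII_gap k : (1 <= k)%N -> (`|g (x k) - g xopt| <= (psi beta nu * t k)%:E)%E.
Proof.
case: k => // k _; have [_] := phaseII_step k (phaseII_dist k).
have [Dx gx] := phaseII_dom k.+1; have [_ /(_ (x k.+1))] := xopt_min.
rewrite -(scb_Dom f_barrier) => /(_ (subset_closure Dx)) le_opt.
have gopt : edom g xopt by exact: le_lt_trans le_opt gx.
move: le_opt; rewrite (proper_fineE g_proper _ gx) (proper_fineE g_proper _ gopt) lee_fin /G.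
move: (fine (g (x k.+1))) (fine (g xopt)) (psi beta nu * t k.+1) => a b c ba H.
by rewrite -EFinB abse_EFin lee_fin ger0_norm// subr_ge0.
Qed.

(** From 1 - sigma <= exp(-sigma), the parameter decays at least like exp(-sigma k). *)
Lemma phaseII_decay eps : 0 < eps ->
  let L := ln (t 0%N * psi beta nu / eps) in
  forall k, L <= sigma beta nu * k%:R -> psi beta nu * t k <= eps.
Proof.
move=> eps0 L k Lk; have psi0 := psi_gt0 beta _ beta_gt0 beta_le kE nu nu_gt0.
have q0 : 0 < t 0%N * psi beta nu / eps by rewrite divr_gt0// mulr_gt0// (p2_t0 run).
have /andP[s0 s1] := sigma_itv.
have : (1 - sigma beta nu) ^+ k <= expR (- L).
  apply: le_trans (_ : expR (- sigma beta nu) ^+ k <= _).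
    by rewrite lerXn2r ?nnegrE ?expR_ge0 ?subr_ge0 ?(ltW s1)// expR_ge1Dx.
  by rewrite -expRM_natr ler_expR mulNr lerN2.
rewrite expRN lnK ?posrE// invf_div => H.
rewrite phaseII_t mulrCA [_ * t 0%N]mulrC.
by rewrite -ler_pdivlMr// mulr_gt0// (p2_t0 run).
Qed.

Lemma phaseII_complexity eps : 0 < eps ->
  eps <= expR (-1) * (t 0%N * psi beta nu) ->
  exists N : nat,
    [/\ (1 <= N)%N,
        N%:R <= ((1 + C) / C + 1) * (Num.sqrt nu * ln (t 0%N * psi beta nu / eps)) &
        forall k : nat, (N <= k)%N -> (`|g (x k) - g xopt| <= eps%:E)%E].
Proof.
move=> eps0 eps_le; set L := ln _.
have psi0 := psi_gt0 beta _ beta_gt0 beta_le kE nu nu_gt0.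
have /andP[s0 s1] := sigma_itv.
have L1 : 1 <= L.
  rewrite -[X in X <= _]expRK ler_ln ?posrE ?expR_gt0//.
    by rewrite ler_pdivlMr// -ler_pdivlMl ?expR_gt0// -expRN.
  by rewrite divr_gt0// mulr_gt0// (p2_t0 run).
have L0 : 0 <= L / sigma beta nu by rewrite divr_ge0 ?(ltW s0)// (le_trans ler01).
have /andP[tr_le tr_gt] := Num.Theory.truncn_itv L0.
(* This is the first integer above L / sigma. Rounding costs at most 1, absorbed into the constant
   because sqrt(nu) and L are both at least 1. *)
exists (Num.truncn (L / sigma beta nu)).+1; split => //.
  have nuL : 1 <= Num.sqrt nu * L by rewrite mulr_ege1// barrier_sqrt_ge1.
  have E : L / sigma beta nu = (1 + C) / C * (Num.sqrt nu * L).
    have C1 : 0 < 1 + C by rewrite addr_gt0.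
    have := sigma_sqrt; move: (sigma beta nu) (Num.sqrt nu) s0 sqrt_nu_gt0 => a b a0 b0 E.
    have -> : a = C / (1 + C) / b by rewrite -E mulfK// gt_eqF.
    by field; rewrite (gt_eqF C_gt0) (gt_eqF C1) (gt_eqF b0).
  by rewrite -natr1 mulrDl mul1r -E lerD.
move=> k Nk; have k1 : (1 <= k)%N := leq_trans (ltn0Sn _) Nk.
apply: le_trans (phaseII_gap k k1) _; rewrite lee_fin; apply: phaseII_decay => //.
rewrite -/L (mulrC (sigma beta nu)) -ler_pdivrMr//; apply: le_trans (ltW tr_gt) _.
by rewrite ler_nat.
Qed.

End PhaseII.

(* The constants K (the one implied by the O) and c (the threshold defining
   "eps small relative to t_0 psi(beta, nu)") depend on beta only. *)
Theorem theorem5p2 (R : realType) (beta : R) (hbeta : 0 < beta <= 15 / 100) :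
  exists K c : R, [/\ 0 < K, 0 < c &
    forall (n : nat) (Omega D : set 'cV[R]_n) (f : 'cV[R]_n -> R)
      (g : 'cV[R]_n -> \bar R) (nu : R) (xopt : 'cV[R]_n)
      (t delta : nat -> R) (x xs xbar : nat -> 'cV[R]_n),
    (0 < n)%N ->
    Omega !=set0 -> closed Omega -> convex_set Omega ->
    sc_barrier nu Omega D f ->
    (forall y, D y -> posdef (hess f y)) ->
    eproper g -> lower_semicontinuous g -> econvex g ->
    is_argmin Omega g xopt ->
    phaseII D f g nu beta t delta x xs xbar ->
    (forall k : nat, (1 <= k)%N ->
       (`|g (x k) - g xopt| <= (psi beta nu * t k)%:E)%E) /\
    (forall eps : R, 0 < eps -> eps <= c * (t 0%N * psi beta nu) ->
       exists N : nat,
         [/\ (1 <= N)%N,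
             N%:R <= K * (Num.sqrt nu * ln (t 0%N * psi beta nu / eps)) &
             forall k : nat, (N <= k)%N ->
               (`|g (x k) - g xopt| <= eps%:E)%E])].
Proof.
have /andP[beta0 beta1] := hbeta.
have kE : 1000 * (2581 / 1000) = 2581 :> R by lra.
have C0 : 0 < Cbeta beta := path_const_gt0 beta _ _ beta0 beta1 kE erefl.
(* (1 + C) / C is 1 / sigma without its factor sqrt(nu), and the added 1 pays for rounding; the
   threshold exp(-1) makes the logarithm at least 1. *)
exists ((1 + Cbeta beta) / Cbeta beta + 1), (expR (-1)); split.
- by apply: addr_gt0 => //; apply: divr_gt0 => //; apply: addr_gt0.
- exact: expR_gt0.
move=> n Omega D f g nu xopt t delta x xs xbar n0 _ _ _ fb hess0 gp _ gc opt run; split.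
  by move=> k; exact: (phaseII_gap n0 beta0 beta1 fb hess0 gp gc opt run).
by move=> eps; exact: (phaseII_complexity n0 beta0 beta1 fb hess0 gp gc opt run).
Qed.
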